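(* Let $n\ge2$. For any partition $\mu$ and composition $\lambda=(\lambda_1,\dots,\lambda_n)\in(\mathbf Z_{\ge0})^n$ such that $|\lambda|=|\mu|$ and $\mu_1\le n-1$ we have $$\sum_{\eta\,(\eta_1\le n)}K_{\eta'\lambda}K_{\eta\mu}(q)=\sum_{\{\nu\}}\ \prod_{\substack{1\le a\le n-1\\1\le i\le\mu_1}}\begin{bmatrix}\nu^{(a+1)}_i-\nu^{(a+1)}_{i+1}\\ \nu^{(a)}_i-\nu^{(a+1)}_{i+1}\end{bmatrix},$$ where the sum $\sum_{\{\nu\}}$ runs over the sequences of Young diagrams $\nu^{(1)},\dots,\nu^{(n-1)}$ such that $$\emptyset=:\nu^{(0)}\subset\nu^{(1)}\subset\cdots\subset\nu^{(n-1)}\subset\nu^{(n)}:=\mu'$$ and each $\nu^{(a)}/\nu^{(a-1)}$ is a horizontal strip of length $\lambda_a$.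
   Context: $K_{\eta\mu}(q)$ is the Kostka–Foulkes polynomial, defined by $s_\eta(x)=\sum_\mu K_{\eta\mu}(q)P_\mu(x;q)$ with $P_\mu(x;q)$ the Hall–Littlewood polynomial; $K_{\xi\lambda}=K_{\xi\lambda}(1)$ is the Kostka number, extended to compositions $\lambda$ by invariance under permutation of the components of $\lambda$. The sum on the left is over partitions $\eta$ of $|\mu|$ with $\eta_1\le n$; primes denote conjugate partitions. $\nu^{(a)}_i$ is the $i$-th part of $\nu^{(a)}$ (zero beyond its length). A horizontal strip of length $k$ is a skew diagram with $k$ nodes, at most one in each column. $\begin{bmatrix}m\\k\end{bmatrix}=\frac{(q)_m}{(q)_k(q)_{m-k}}$ if $0\le k\le m$ and $0$ otherwise, where $(q)_m=\prod_{i=1}^m(1-q^i)$. *)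

(* Defs.v *)
From HB Require Import structures.
From mathcomp Require Import all_boot all_order all_fingroup all_algebra.
From mathcomp Require Import mpoly.
From Stdlib Require ClassicalEpsilon.

Set Implicit Arguments.
Unset Strict Implicit.
Unset Printing Implicit Defensive.

Import GRing.Theory.
Local Open Scope ring_scope.

(* Partitions are nonincreasing sequences of positive integers. *)
Definition is_partition (mu : seq nat) : bool := sorted geq mu && (0%N \notin mu).

(* mu_i, indexed from 1 *)
Definition part (mu : seq nat) (i : nat) : nat := nth 0%N mu i.-1.

Definition conj_part (mu : seq nat) : seq nat :=
  [seq count (fun x => (j < x)%N) mu | j <- iota 0 (head 0%N mu)].

Definition to_partition (s : seq nat) : seq nat := [seq x <- sort geq s | (0 < x)%N].

Definition partitions (d : nat) : seq (seq nat) :=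
  undup [seq to_partition (map val (tval t))
        | t <- enum {: d.-tuple 'I_d.+1} & sumn (map val (tval t)) == d].

Lemma geq_trans : transitive geq.
Proof. by move=> b a c /= Hab Hbc; exact: leq_trans Hbc Hab. Qed.

Lemma geq_total : total geq.
Proof. by move=> a b; rewrite /= leq_total. Qed.

Lemma to_partitionP (s : seq nat) : is_partition (to_partition s).
Proof.
rewrite /is_partition mem_filter andbT.
apply: sorted_filter; [exact: geq_trans | exact/sort_sorted/geq_total].
Qed.

Lemma sumn_to_partition (s : seq nat) : sumn (to_partition s) = sumn s.
Proof.
have -> : sumn (to_partition s) = sumn (sort geq s).
  by rewrite /to_partition; elim: (sort geq s) => [|[|x] r IH] //=; rewrite IH.
by apply/perm_sumn; rewrite perm_sort.
Qed.

Lemma mem_partitions (d : nat) (mu : seq nat) :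
  (mu \in partitions d) = is_partition mu && (sumn mu == d).
Proof.
rewrite mem_undup; apply/mapP/idP => [[t]|/andP[Hp /eqP Hd]].
  rewrite mem_filter => /andP[/eqP Ht _] ->.
  by rewrite to_partitionP sumn_to_partition Ht eqxx.
have Hsz : (size mu <= d)%N.
  rewrite -Hd; case/andP: Hp => _; elim: mu {Hd} => [|[|x] r IH] //=.
  rewrite inE /= => /IH Hr; rewrite addSn ltnS; exact: leq_trans Hr (leq_addl _ _).
have Hle x : x \in mu -> (x <= d)%N.
  rewrite -Hd; elim: mu {Hp Hd Hsz} => [|y r IH] //=; rewrite inE.
  case/orP => [/eqP ->|/IH H]; first exact: leq_addr.
  exact: leq_trans H (leq_addl _ _).
pose s := mu ++ nseq (d - size mu) 0%N.
have Hs : size [seq inord x : 'I_d.+1 | x <- s] == d.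
  by rewrite size_map size_cat size_nseq subnKC.
exists (Tuple Hs).
  rewrite mem_filter mem_enum inE andbT /= -map_comp.
  have -> : [seq (val \o (fun x => inord x : 'I_d.+1)) x | x <- s] = s.
    rewrite -[RHS]map_id; apply/eq_in_map => x Hx /=; rewrite inordK // ltnS.
    move: Hx; rewrite mem_cat => /orP[/Hle //|].
    by rewrite mem_nseq => /andP[_ /eqP ->].
  by rewrite sumn_cat sumn_nseq mul0n addn0 Hd.
rewrite /= -map_comp.
have -> : [seq (val \o (fun x => inord x : 'I_d.+1)) x | x <- s] = s.
  rewrite -[RHS]map_id; apply/eq_in_map => x Hx /=; rewrite inordK // ltnS.
  move: Hx; rewrite mem_cat => /orP[/Hle //|].
  by rewrite mem_nseq => /andP[_ /eqP ->].
case/andP: Hp => Hsort H0.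
rewrite /to_partition sorted_sort; [|exact: geq_trans|].
  rewrite filter_cat (_ : [seq x <- nseq _ _ | _] = [::]) ?cats0; last first.
    by elim: (d - size mu)%N => //=.
  symmetry; apply/all_filterP/allP => x Hx; rewrite lt0n.
  by apply: contraNneq H0 => <-.
rewrite /s; elim: mu Hsort {H0 Hd Hsz Hle s Hs} (d - size mu)%N => [|x r IH] /=.
  by move=> _; elim=> [|[|n] IHn] //=.
move=> Hr n; rewrite path_sortedE; last exact: geq_trans.
move: Hr; rewrite path_sortedE; last exact: geq_trans.
case/andP=> Hall Hr; rewrite IH // andbT all_cat Hall /=.
by apply/allP => y; rewrite mem_nseq => /andP[_ /eqP ->].
Qed.

Lemma partitions_uniq (d : nat) : uniq (partitions d).
Proof. exact: undup_uniq. Qed.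

(* The bialternant formula in the N variables x_0, .., x_(N-1); it represents
   s_eta(x) when size eta <= N. *)
Definition schur (F : fieldType) (N : nat) (x : 'I_N -> F) (eta : seq nat) : F :=
  \det (\matrix_(i < N, j < N) x i ^+ (nth 0%N eta j + (N - j.+1))%N)
  / \det (\matrix_(i < N, j < N) x i ^+ (N - j.+1)%N).

(* Macdonald's normalization v_mu(t) = prod_(i >= 0) v_(m_i)(t), where
   v_m(t) = prod_(1 <= k <= m) (1 - t^k) / (1 - t) and m_i is the multiplicity
   of i in mu padded with zeros to length N. *)
Definition HL_norm (F : fieldType) (t : F) (N : nat) (mu : seq nat) : F :=
  \prod_(0 <= i < (sumn mu).+1)
    \prod_(1 <= k < #|[set j : 'I_N | nth 0%N mu j == i]|.+1)
      ((1 - t ^+ k) / (1 - t)).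

(* The Hall-Littlewood polynomial P_mu(x_0, .., x_(N-1); t), size mu <= N:
   (1 / v_mu(t)) sum_(w in S_N)
     w (x^mu prod_(i < j) (x_i - t x_j) / (x_i - x_j)). *)
Definition HallLittlewood (F : fieldType) (t : F) (N : nat) (x : 'I_N -> F)
    (mu : seq nat) : F :=
  (HL_norm t N mu)^-1 *
  \sum_(w : 'S_N)
    (\prod_(i < N) x (w i) ^+ nth 0%N mu i) *
    \prod_(i < N) \prod_(j < N | (i < j)%N)
      ((x (w i) - t * x (w j)) / (x (w i) - x (w j))).

(* The field of rational functions Frac(Z[q][x_0, .., x_(N-1)]), its
   variables, and the embedding of Z[q]. *)
Definition ratfun (N : nat) : fieldType := {fraction {mpoly {poly int}[N]}}.

Definition xvar (N : nat) (i : 'I_N) : ratfun N := tofrac ('X_i : {mpoly {poly int}[N]}).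

Definition qcoef (N : nat) (c : {poly int}) : ratfun N :=
  tofrac (c%:MP_[N] : {mpoly {poly int}[N]}).

(* s_eta(x) = sum_mu K_(eta,mu)(q) P_mu(x;q) in every number N of variables
   for which s_eta is nonzero.  By homogeneity only |mu| = |eta| occurs, and
   the P_mu with more than N parts vanish. *)
Definition is_KostkaFoulkes (K : seq nat -> seq nat -> {poly int}) : Prop :=
  forall (N : nat) (eta : seq nat), is_partition eta -> (size eta <= N)%N ->
    schur (@xvar N) eta =
    \sum_(mu <- partitions (sumn eta) | (size mu <= N)%N)
      qcoef N (K eta mu) * HallLittlewood (qcoef N 'X) (@xvar N) mu.

(* On pairs of partitions of the same integer, is_KostkaFoulkes determines K;
   elsewhere the value is arbitrary. *)
Definition KostkaFoulkes : seq nat -> seq nat -> {poly int} :=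
  ClassicalEpsilon.epsilon (inhabits (fun _ _ => 0)) is_KostkaFoulkes.

Definition Kostka (xi lam : seq nat) : int :=
  (KostkaFoulkes xi (to_partition lam)).[1].

(* The nodes (row, column) of the skew diagram rho / nu, counted from 0. *)
Definition skew_nodes (rho nu : seq nat) : seq (nat * nat) :=
  [seq (i, j) | i <- iota 0 (size rho),
                j <- iota (nth 0%N nu i) (nth 0%N rho i - nth 0%N nu i)].

Definition included (nu rho : seq nat) : bool :=
  [forall i : 'I_(size nu), (nth 0%N nu i <= nth 0%N rho i)%N].

Definition horizontal_strip (rho nu : seq nat) (k : nat) : bool :=
  [&& included nu rho, size (skew_nodes rho nu) == k
    & uniq (unzip2 (skew_nodes rho nu))].

(* The finite type of Young diagrams with at most M nodes. *)
Definition diagram (M : nat) : finType :=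
  seq_sub (flatten [seq partitions d | d <- iota 0 M.+1]).

(* The extended sequence nu^(0) = empty, nu^(1), .., nu^(n-1), nu^(n) = top;
   its a-th entry is nu^(a). *)
Definition full_chain (M m : nat) (nu : m.-tuple (diagram M)) (top : seq nat) :
    seq (seq nat) :=
  [::] :: rcons (map val nu) top.

Definition strip_chain (n : nat) (lam : n.-tuple nat) (c : seq (seq nat)) : bool :=
  all (fun a => horizontal_strip (nth [::] c a) (nth [::] c a.-1) (part lam a))
      (iota 1 n).

(* (q)_m, and the q-binomial coefficient as a quotient in Frac(Z[q]) *)
Definition qfact (m : nat) : {fraction {poly int}} :=
  tofrac (\prod_(1 <= i < m.+1) (1 - 'X^i) : {poly int}).

Definition qbinom (m k : int) : {fraction {poly int}} :=
  if (0 <= k <= m)%R then qfact `|m|%N / (qfact `|k|%N * qfact `|m - k|%N) else 0.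

(* Main.v *)
Require Import Defs.
From HB Require Import structures.
From mathcomp Require Import all_boot all_order all_fingroup all_algebra.
From mathcomp Require Import mpoly zify ring.

(* Both sides are the coefficient of P_mu(x;q) in e_lambda = e_(lambda_1) ...
   e_(lambda_n).

   On the right this is the iterated Pieri rule for Hall-Littlewood polynomials,
   written for conjugate partitions: e_r acts on the unnormalized symmetrization
   R_alpha by R_alpha -> sum_S R_(alpha + 1_S), |S| = r, and the relation
   R_(.., a, a+1, ..) = q R_(.., a+1, a, ..) turns the sum over the subsets of a
   block of equal entries into a q-binomial coefficient.

   On the left one expands e_lambda in Schur polynomials (the case q = 0 of the
   same rule) and these in the P_mu.  It remains to see that the Kostka number
   K_(eta', lambda), defined as K_(eta', lambda)(q) at q = 1, counts the chains of
   horizontal strips of contents lambda ending at eta'.  With A(q) the matrix of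
   Pieri coefficients, K(q) = A(0)^-1 A(q), so this is the dual RSK identity
   sum_eta A(0)_(nu, eta) A(0)_(lambda, eta') = A(1)_(nu, lambda'), which follows
   from the commutation relation between adding a vertical strip and removing a
   horizontal one. *)

Set Implicit Arguments.
Unset Strict Implicit.
Unset Printing Implicit Defensive.

Import GRing.Theory.
Local Open Scope ring_scope.

(** * Words and the Pieri rule *)

(** The sum over the increments of a word uses only the exchange rule, and is therefore treated for
    arbitrary functions of words and arbitrary t. It serves three times: at t = q for the
    symmetrizations, at t = 0 for Kostka numbers extended by zero to unsorted words, at t = 1 for
    symmetric functions of the contents. [KostkaFoulkes] is an [epsilon], so nothing is known of it
    before some family of polynomials satisfies the defining expansion. Unitriangularity of A(0)
    over the integers supplies one, and that family is the identity matrix at q = 0. Its determinant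
    is thus nonzero and the P_mu inherit the independence of the Schur polynomials. Every comparison
    of coefficients rests on this, as does the symmetry of A(q) in lambda, which comes from
    commuting the e_r and not from a bijection on tableaux. Conjugate partitions are lists padded
    with zeros to a fixed length L above the degree; their last entry is zero, so a further strip
    always fits. *)

Fixpoint gbin (R : comNzRingType) (t : R) (m k : nat) : R :=
  match k, m with
  | 0, _ => 1
  | _.+1, 0 => 0
  | k'.+1, m'.+1 => gbin t m' k + t ^+ (m' - k') * gbin t m' k'
  end.

Lemma gbin0 (R : comNzRingType) (t : R) m : gbin t m 0 = 1.
Proof. by case: m. Qed.

Lemma gbin_small (R : comNzRingType) (t : R) m k : (m < k)%N -> gbin t m k = 0.
Proof.
elim: m k => [|m IH] [|k] //= Hk.
by rewrite !IH ?mulr0 ?addr0 //; lia.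
Qed.

Lemma gbin_full (R : comNzRingType) (t : R) m : gbin t m m = 1.
Proof. by elim: m => [|m IH] //=; rewrite gbin_small // subnn expr0 IH add0r mulr1. Qed.

Lemma gbin_at0 (R : comNzRingType) m k : (k <= m)%N -> gbin (0 : R) m k = 1.
Proof.
elim: m k => [|m IH] [|k] //=; rewrite ltnS leq_eqVlt => /orP[/eqP->|Hk].
  by rewrite gbin_small // subnn gbin_full add0r mulr1.
by rewrite IH // expr0n subn_eq0 leqNgt Hk mul0r addr0.
Qed.

Lemma rmorph_gbin (R S : comNzRingType) (f : {rmorphism R -> S}) (t : R) m k :
  f (gbin t m k) = gbin (f t) m k.
Proof.
elim: m k => [|m IH] [|k] //=; rewrite ?rmorph0 ?rmorph1 //.
by rewrite rmorphD rmorphM rmorphXn !IH.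
Qed.

(** [gbin] is a division-free Pascal recursion, so that t can be set to 0 or 1; this recovers the
    quotient. [phi] is any model of (t)_j: the product itself in Z[q], or v_j(t) (1 - t)^j in a
    field. *)
Lemma gbin_fact (R : comNzRingType) (t : R) (phi : nat -> R) m k :
  phi 0%N = 1 -> (forall j, phi j.+1 = phi j * (1 - t ^+ j.+1)) -> (k <= m)%N ->
  gbin t m k * phi k * phi (m - k)%N = phi m.
Proof.
move=> H0 HS; elim: m k => [|m IH] [|k] //=; rewrite ?H0 ?mulr1 ?mul1r //.
rewrite ltnS => Hk; rewrite subSS HS.
move: Hk; rewrite leq_eqVlt => /orP[/eqP->|Hk].
  by rewrite gbin_small // gbin_full subnn H0 HS; ring.
have H1 := IH k (ltnW Hk); have := IH _ Hk; rewrite HS (HS m) => H2.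
rewrite mulrDl mulrDl.
have E : (m - k = (m - k.+1).+1)%N by lia.
rewrite [X in X + _](_ : _ = (1 - t ^+ (m - k)) * phi m); last first.
  by rewrite -H2 E HS -E; ring.
rewrite [X in _ + X](_ : _ = t ^+ (m - k) * (1 - t ^+ k.+1) * phi m); last first.
  by rewrite -H1; ring.
have -> : t ^+ m.+1 = t ^+ (m - k) * t ^+ k.+1 by rewrite -exprD; congr (_ ^+ _); lia.
by ring.
Qed.

(* A partition is handled through its conjugate s, a list padded with zeros, with
   p in the role of the zeroth column (the number of variables):
   up p s lists the th such that th / s is a horizontal strip, wt t p s th is the
   corresponding product of t-binomials, and word a p s is the nondecreasing word
   whose number of entries >= a is p and whose number of entries > a + j is the
   j-th entry of s, j >= 0. *)
Fixpoint up (p : nat) (s : seq nat) : seq (seq nat) :=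
  if s is x :: s' then [seq y :: th | y <- iota x (p.+1 - x), th <- up x s']
  else [:: [::]].

Fixpoint wt (R : comNzRingType) (t : R) (p : nat) (s th : seq nat) : R :=
  match s, th with
  | x :: s', y :: th' => gbin t (p - x) (y - x) * wt t x s' th'
  | _, _ => 1
  end.

Fixpoint word (a p : nat) (s : seq nat) : seq nat :=
  if s is x :: s' then nseq (p - x) a ++ word a.+1 x s' else nseq p a.

(** The words alpha + 1_S over all subsets S; the size of S is imposed later by fixing the sum of
    the word. *)
Fixpoint inc (w : seq nat) : seq (seq nat) :=
  if w is a :: w' then [seq a :: z | z <- inc w'] ++ [seq a.+1 :: z | z <- inc w']
  else [:: [::]].

Fixpoint dec (w : seq nat) : seq (seq nat) :=
  if w is a :: w' then
    [seq a :: z | z <- dec w'] ++ (if a is a'.+1 then [seq a' :: z | z <- dec w'] else [::])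
  else [:: [::]].

(* The straightening rule of Hall-Littlewood symmetrizations, for functions of
   words of exponents written in nondecreasing order. *)
Definition exchange (R : comNzRingType) (t : R) (f : seq nat -> R) :=
  forall u a v, f (u ++ a.+1 :: a :: v) = t * f (u ++ a :: a.+1 :: v).

Lemma exchange_cat (R : comNzRingType) (t : R) f u :
  exchange t f -> exchange t (fun z => f (u ++ z)).
Proof. by move=> Hf w a v; rewrite !catA Hf. Qed.

Lemma exchange_nseq (R : comNzRingType) (t : R) f u m a v : exchange t f ->
  f (u ++ a.+1 :: nseq m a ++ v) = t ^+ m * f (u ++ nseq m a ++ a.+1 :: v).
Proof.
move=> Hf; elim: m u => [|m IH] u; first by rewrite mul1r.
by rewrite /= Hf exprS -mulrA -(cat1s a) catA IH -!catA.
Qed.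

Lemma sum_inc_cons (V : nmodType) a w (f : seq nat -> V) :
  \sum_(z <- inc (a :: w)) f z
  = \sum_(z <- inc w) f (a :: z) + \sum_(z <- inc w) f (a.+1 :: z).
Proof. by rewrite /= big_cat !big_map. Qed.

(** If the first letter of a block of m + 1 is raised together with k others, moving it past the m -
    k unraised ones costs t^(m - k): this is the second term of the Pascal recursion. *)
Lemma sum_inc_nseq (R : comNzRingType) (t : R) f m a w u : exchange t f ->
  \sum_(z <- inc (nseq m a ++ w)) f (u ++ z)
  = \sum_(0 <= k < m.+1) gbin t m k *
      \sum_(z <- inc w) f (u ++ nseq (m - k) a ++ nseq k a.+1 ++ z).
Proof.
move=> Hf; elim: m u => [|m IH] u; first by rewrite big_nat1 mul1r.
rewrite sum_inc_cons -/(nseq m a).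
under eq_bigr do rewrite -cat1s catA.
rewrite IH.
under [X in _ + X = _]eq_bigr do rewrite -cat1s catA.
rewrite IH.
rewrite [in RHS]big_nat_recl // gbin0 [X in X + _ = _]big_nat_recl // gbin0 !mul1r.
rewrite -addrA; congr (_ + _).
  by rewrite !subn0; apply: eq_bigr => z _; rewrite /= -catA.
rewrite [in X in _ + X = _]big_nat_cond [in RHS]big_nat_cond.
rewrite [in RHS](eq_bigr (fun k => gbin t m k.+1 * (\sum_(z <- inc w)
      f (u ++ nseq (m.+1 - k.+1) a ++ nseq k.+1 a.+1 ++ z)) +
      t ^+ (m - k) * gbin t m k * (\sum_(z <- inc w)
      f (u ++ nseq (m.+1 - k.+1) a ++ nseq k.+1 a.+1 ++ z)))); last first.
  by move=> k _; rewrite -mulrDl.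
rewrite big_split /= -!big_nat_cond; congr (_ + _).
  rewrite big_nat_recr //= gbin_small // mul0r addr0.
  rewrite big_nat_cond [RHS]big_nat_cond; apply: eq_bigr => k /andP[/andP[_ Hk] _].
  congr (_ * _); apply: eq_bigr => z _; congr f.
  have -> : (m.+1 - k.+1 = (m - k.+1).+1)%N by lia.
  by rewrite /= -!catA.
rewrite big_nat_cond [RHS]big_nat_cond; apply: eq_bigr => k /andP[/andP[_ Hk] _].
rewrite [t ^+ _ * _]mulrC -mulrA; congr (_ * _); rewrite mulr_sumr.
by apply: eq_bigr => z _; rewrite -catA /= (exchange_nseq _ _ _ _ Hf) subSS.
Qed.

Lemma big_up (V : nmodType) p x s (f : seq nat -> V) : (x <= p)%N ->
  \sum_(th <- up p (x :: s)) f th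
  = \sum_(0 <= k < (p - x).+1) \sum_(th <- up x s) f ((x + k)%N :: th).
Proof.
move=> Hx; rewrite /= big_allpairs_dep /= subSn //.
by rewrite -[X in iota X _]addn0 iotaDl big_map /index_iota subn0.
Qed.

(** Blocks are summed from the smallest letter upwards. The prefix of y - p letters [a] holds those
    raised from the previous block, so y counts the letters >= a of the new word. As the last entry
    of [s] is zero, the largest letter can be raised without lengthening [s]. *)
Lemma sum_inc_word (R : comNzRingType) (t : R) f a p y s :
  exchange t f -> last p s = 0%N -> path geq p s -> (p <= y)%N ->
  \sum_(z <- inc (word a p s)) f (nseq (y - p) a ++ z)
  = \sum_(th <- up p s) wt t p s th * f (word a y th).
Proof.
elim: s a p y f => [|x s IH] a p y f Hf /=.
  by move=> -> _ _; rewrite !big_seq1 mul1r subn0 cats0.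
move=> Hl /andP[Hx Hs] Hy; rewrite (sum_inc_nseq _ _ _ _ Hf) big_up //.
rewrite big_nat_cond [RHS]big_nat_cond; apply: eq_bigr => k /andP[/andP[_ Hk] _].
rewrite addKn -(eq_bigr _ (fun _ _ => mulrA _ _ _)) -mulr_sumr.
congr (_ * _); have := IH a.+1 x (x + k)%N _ (exchange_cat (nseq (y - (x + k)) a) Hf) Hl Hs (leq_addr _ _).
rewrite addKn => <-; apply: eq_bigr => z _.
rewrite !catA -nseqD; congr (f ((nseq _ _ ++ _) ++ _)); lia.
Qed.

(** rho / nu is a horizontal strip when rho_(i+1) <= nu_i <= rho_i, that is, when nu is a horizontal
    strip over rho deprived of its first entry, with nu_1 <= rho_1. Hence [up] and [wt] can be
    reused. *)
Definition dn (rho : seq nat) := up (head 0%N rho) (rcons (behead rho) 0%N).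

(** With rho = nu^(a+1) and nu = nu^(a) this is the product over i in the theorem. *)
Definition dnwt (R : comNzRingType) (t : R) (rho nu : seq nat) : R :=
  wt t (head 0%N rho) (rcons (behead rho) 0%N) nu.

(* The coefficient of P_mu in the product of the e_r, r in al, where rho is the
   conjugate of mu padded with zeros. *)
Fixpoint Acoef (R : comNzRingType) (t : R) (al rho : seq nat) : R :=
  if al is r :: al' then
    \sum_(nu <- dn rho | sumn nu + r == sumn rho) dnwt t rho nu * Acoef t al' nu
  else (all (pred1 0%N) rho)%:R.

Lemma rmorph_wt (R S : comNzRingType) (f : {rmorphism R -> S}) (t : R) p s th :
  f (wt t p s th) = wt (f t) p s th.
Proof.
elim: s p th => [|x s IH] p [|y th] /=; rewrite ?rmorph1 //.
by rewrite rmorphM rmorph_gbin IH.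
Qed.

Lemma rmorph_Acoef (R S : comNzRingType) (f : {rmorphism R -> S}) (t : R) al rho :
  f (Acoef t al rho) = Acoef (f t) al rho.
Proof.
elim: al rho => [|r al IH] rho /=; first by rewrite rmorph_nat.
by rewrite rmorph_sum; apply: eq_bigr => nu _; rewrite rmorphM rmorph_wt IH.
Qed.

Lemma mem_up p (s th : seq nat) : (th \in up p s) =
  [&& size th == size s &
   all (fun i => (nth 0 s i <= nth 0 th i <= nth 0 (p :: s) i)%N) (iota 0 (size s))].
Proof.
elim: s p th => [|x s IH] p th; first by case: th.
have {}IH := IH x.
apply/allpairsPdep/idP => [[y [z [Hy Hz ->]]]|].
  move: Hz; rewrite IH /= eqSS => /andP[-> Hz] /=.
  rewrite -[1%N]addn0 iotaDl all_map; apply/andP; split; last exact: Hz.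
  by move: Hy; rewrite mem_iota; lia.
case: th => [|y z] //= /and3P[Hs Hy Hz]; exists y, z; split => //.
  by rewrite mem_iota; lia.
rewrite IH -eqSS Hs /=; move: Hz; rewrite -[1%N]addn0 iotaDl all_map; exact.
Qed.

Lemma up_uniq p s : uniq (up p s).
Proof.
elim: s p => [|x s IH] p //=; apply: allpairs_uniq_dep; rewrite ?iota_uniq //.
by move=> [a b] [c d] _ _ /= [-> ->].
Qed.

Lemma upP p (s th : seq nat) : reflect (size th = size s /\ forall i, (i < size s)%N ->
   (nth 0 s i <= nth 0 th i)%N /\ (nth 0 th i <= nth 0 (p :: s) i)%N) (th \in up p s).
Proof.
rewrite mem_up; apply: (iffP andP) => [[/eqP Hs /allP H]|[Hs H]].
  by split=> // i Hi; apply/andP/H; rewrite mem_iota.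
split; first exact/eqP.
by apply/allP => i; rewrite mem_iota => Hi; apply/andP/H.
Qed.

Lemma dn_uniq rho : uniq (dn rho). Proof. exact: up_uniq. Qed.

Lemma dnP (rho nu : seq nat) : (0 < size rho)%N -> reflect (size nu = size rho /\ forall i,
   (nth 0 rho i.+1 <= nth 0 nu i)%N /\ (nth 0 nu i <= nth 0 rho i)%N) (nu \in dn rho).
Proof.
case: rho => // p s _; apply: (iffP (upP _ _ _)); rewrite /= size_rcons.
  move=> [Hs H]; split=> // i; case: (ltnP i (size s).+1) => Hi.
    have [] := H i Hi; rewrite -rcons_cons !nth_rcons /= Hi => H1 H2; split => //.
    by case: ltnP H1 => // Hi2; rewrite [nth _ s i]nth_default //; case: eqP.
  by rewrite !nth_default ?Hs //=; lia.
move=> [Hs H]; split=> // i Hi; have [H1 H2] := H i.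
rewrite -rcons_cons !nth_rcons /= Hi; split => //.
case: ltnP => Hi2; first exact: H1.
by case: eqP.
Qed.

Lemma sumn_word a p (s : seq nat) : path geq p s -> sumn (word a p s) = (a * p + sumn s)%N.
Proof.
elim: s a p => [|x s IH] a p /=; first by rewrite sumn_nseq mulnC addn0 mulnC.
move=> /andP[Hx Hs]; rewrite sumn_cat sumn_nseq IH // mulSn.
have -> : (p = (p - x) + x)%N by rewrite subnK.
by rewrite addnK; nia.
Qed.

Lemma size_word a p (s : seq nat) : path geq p s -> size (word a p s) = p.
Proof.
elim: s a p => [|x s IH] a p /=; first by rewrite size_nseq.
by move=> /andP[Hx Hs]; rewrite size_cat size_nseq IH // subnK.
Qed.

Lemma size_inc (w z : seq nat) : z \in inc w -> size z = size w.
Proof.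
elim: w z => [|a w IH] z /=; first by rewrite inE => /eqP->.
by rewrite mem_cat => /orP[] /mapP[y /IH Hy ->] /=; rewrite Hy.
Qed.

(** * Partitions as lists of fixed length, and their conjugates *)

Fixpoint parts (L N : nat) : seq (seq nat) :=
  if L is L'.+1 then [seq x :: s | x <- iota 0 N.+1, s <- parts L' x] else [:: [::]].

Lemma mem_parts L N (s : seq nat) : (s \in parts L N) = (size s == L) && path geq N s.
Proof.
elim: L N s => [|L IH] N s; first by rewrite inE size_eq0; case: eqP => // ->.
apply/allpairsPdep/idP => [[x [y [Hx Hy ->]]]|].
  have {}Hx : x \in iota 0 N.+1 by [].
  rewrite mem_iota in Hx.
  by move: Hy; rewrite IH /= eqSS => /andP[-> ->]; rewrite andbT; lia.
case: s => [|x s] //= /and3P[Hs Hx Hp]; exists x, s; split=> //.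
  by rewrite -[X in x \in X]/(iota 0 N.+1) mem_iota; lia.
by rewrite IH -eqSS Hs.
Qed.

Lemma parts_uniq L N : uniq (parts L N).
Proof.
elim: L N => // L IH N; apply: (@allpairs_uniq_dep _ (fun=> _)); rewrite ?iota_uniq //.
by move=> [a b] [c d] _ _ /= [-> ->].
Qed.

Lemma path_geqP N (s : seq nat) :
  reflect (forall i, (nth 0 s i <= nth 0 (N :: s) i)%N) (path geq N s).
Proof.
elim: s N => [|x s IH] N /=; first by constructor=> i; rewrite nth_nil.
apply: (iffP andP) => [[Hx /IH H] [|i]|H] //=.
by split; [have := H 0%N|apply/IH => i; have := H i.+1].
Qed.

Lemma partsP L N (s : seq nat) : reflect (size s = L /\ forall i, (nth 0 s i <= nth 0 (N :: s) i)%N)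
  (s \in parts L N).
Proof. by rewrite mem_parts; apply: (iffP andP) => -[] => [/eqP->|->] /path_geqP. Qed.

Lemma last_parts L N (s : seq nat) : s \in parts L N -> (sumn s < L)%N -> last N s = 0%N.
Proof.
rewrite mem_parts => /andP[/eqP<-].
elim: s N => [|x s IH] N //= /andP[_ Hp] Hs.
case: (ltnP (sumn s) (size s)) => H; first exact: IH.
have Hx : x = 0%N by lia.
move: Hp; rewrite Hx; elim: {IH Hx H Hs x} s => //= x s IH /andP[].
by rewrite leqn0 => /eqP->.
Qed.

Lemma sum_sub (T : eqType) (V : nmodType) (s1 s2 : seq T) (f : T -> V) :
  uniq s1 -> uniq s2 -> {subset s1 <= s2} ->
  \sum_(x <- s1) f x = \sum_(x <- s2 | x \in s1) f x.
Proof.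
move=> U1 U2 H; rewrite -[RHS]big_filter; apply/perm_big/uniq_perm => //.
  exact: filter_uniq.
by move=> x; rewrite mem_filter; case: (boolP (x \in s1)) => // /H ->.
Qed.

Lemma dn_parts L N (th ka : seq nat) : (0 < L)%N -> th \in parts L N -> ka \in dn th ->
  ka \in parts L N /\ th \in up N ka.
Proof.
move=> HL /partsP[Hs H]; rewrite -Hs in HL; move=> /(dnP _ HL)[Hs2 H2].
split.
  apply/partsP; split; first by rewrite Hs2.
  case=> [|i] /=; first by have := H 0%N; have [] := H2 0%N => /=; lia.
  by have [_ ?] := H2 i.+1; have [? _] := H2 i; lia.
apply/upP; rewrite Hs2; split=> // i _; split; first by have [] := H2 i.
by case: i => [|i] /=; [exact: (H 0%N)|have [] := H2 i].
Qed.

Lemma up_parts L N (th ka : seq nat) : (0 < L)%N -> ka \in parts L N -> th \in up N ka ->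
  th \in parts L N /\ ka \in dn th.
Proof.
move=> HL /partsP[Hs H] /upP[Hs2 H2]; rewrite Hs in Hs2 H2.
have {}H2 i : (nth 0 ka i <= nth 0 th i)%N /\ (nth 0 th i <= nth 0 (N :: ka) i)%N.
  by case: (ltnP i L) => [/H2 //|Hi]; rewrite [nth 0 th i]nth_default ?Hs2 // nth_default ?Hs.
split.
  apply/partsP; split=> // -[|i] /=; first by have [] := H2 0%N.
  by have [_ ?] := H2 i.+1; have [? _] := H2 i; simpl in *; lia.
apply/dnP; rewrite Hs2 ?Hs //; split=> // i; have [? _] := H2 i; split=> //.
by have [] := H2 i.+1.
Qed.

(** Both sides run over the pairs in [parts L N] with th / ka a horizontal strip. This passes
    between removing strips, as in [Acoef], and adding them, as in the Pieri rule. *)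
Lemma exchange_dn_up (V : nmodType) L N (f : seq nat -> seq nat -> V) : (0 < L)%N ->
  \sum_(th <- parts L N) \sum_(ka <- dn th) f th ka
  = \sum_(ka <- parts L N) \sum_(th <- up N ka) f th ka.
Proof.
move=> HL.
have -> : \sum_(th <- parts L N) \sum_(ka <- dn th) f th ka =
    \sum_(th <- parts L N) \sum_(ka <- parts L N | ka \in dn th) f th ka.
  rewrite big_seq [RHS]big_seq; apply: eq_bigr => th Hth; apply: sum_sub.
  - exact: dn_uniq.
  - exact: parts_uniq.
  - by move=> ka /(dn_parts HL Hth)[].
have -> : \sum_(ka <- parts L N) \sum_(th <- up N ka) f th ka =
    \sum_(ka <- parts L N) \sum_(th <- parts L N | th \in up N ka) f th ka.
  rewrite big_seq [RHS]big_seq; apply: eq_bigr => ka Hka; apply: sum_sub.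
  - exact: up_uniq.
  - exact: parts_uniq.
  - by move=> th /(up_parts HL Hka)[].
under eq_bigr do rewrite big_mkcond.
rewrite exchange_big /=; rewrite big_seq [RHS]big_seq; apply: eq_bigr => ka Hka.
rewrite [RHS]big_mkcond big_seq [RHS]big_seq; apply: eq_bigr => th Hth.
suff -> : (ka \in dn th) = (th \in up N ka) by [].
by apply/idP/idP => [/(dn_parts HL Hth)[]|/(up_parts HL Hka)[]].
Qed.

Definition cj (L : nat) (mu : seq nat) : seq nat :=
  mkseq (fun j => count (fun x => (j < x)%N) mu) L.

Definition pad (L : nat) (s : seq nat) : seq nat := mkseq (nth 0%N s) L.

Lemma size_cj L mu : size (cj L mu) = L. Proof. exact: size_mkseq. Qed.

Lemma sorted_geq_nth (s : seq nat) i : sorted geq s -> (nth 0 s i.+1 <= nth 0 s i)%N.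
Proof. by case: s => [|x s] //= /path_geqP H; exact: H. Qed.

Lemma leq_head_sorted (s : seq nat) x : sorted geq s -> x \in s -> (x <= head 0 s)%N.
Proof.
case: s => [|y s] //=; rewrite path_sortedE; last exact: geq_trans.
by move=> /andP[/allP H _]; rewrite inE => /orP[/eqP->|/H].
Qed.

Lemma pad_conj L mu : is_partition mu -> pad L (conj_part mu) = cj L mu.
Proof.
move=> /andP[Hs _]; apply: (@eq_from_nth _ 0%N); rewrite !size_mkseq // => i Hi.
rewrite [LHS]nth_mkseq // [RHS]nth_mkseq //; case: (ltnP i (head 0%N mu)) => Hh.
  by rewrite /conj_part (nth_map 0%N) ?size_iota // nth_iota.
rewrite nth_default ?size_map ?size_iota //; symmetry; apply/eqP.
rewrite -leqn0 leqNgt -has_count; apply/hasPn => x /(leq_head_sorted Hs).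
by rewrite -leqNgt => H; exact: leq_trans H Hh.
Qed.

Lemma path_cj L N mu : (size mu <= N)%N -> path geq N (cj L mu).
Proof.
move=> HN; apply/path_geqP => i; case: (ltnP i L) => Hi; last first.
  by rewrite nth_default ?size_cj.
rewrite nth_mkseq //; case: i Hi => [|i] Hi /=.
  exact: leq_trans (count_size _ _) HN.
by rewrite nth_mkseq ?(ltnW Hi) //; apply: sub_count => x /=; lia.
Qed.

Lemma cj_parts L N mu : (size mu <= N)%N -> cj L mu \in parts L N.
Proof. by move=> H; rewrite mem_parts size_cj eqxx path_cj. Qed.

Lemma count_word a p (s : seq nat) j : path geq p s ->
  count (fun x => (a + j < x)%N) (word a p s) = nth 0%N s j.
Proof.
elim: s a p j => [|x s IH] a p j /=.
  by move=> _; rewrite count_nseq nth_nil; case: ltnP => //; lia.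
move=> /andP[Hx Hs]; rewrite count_cat count_nseq.
have -> : (a + j < a)%N = false by lia.
rewrite mul0n add0n; case: j => [|j] /=; last by rewrite addnS -addSn IH.
rewrite addn0 -[RHS](size_word a.+1 Hs); apply/eqP; rewrite -all_count.
elim: s x {IH Hx} a Hs => [|y s IH] x a /=; first by rewrite all_nseq ltnSn orbT.
move=> /andP[_ Hs]; rewrite all_cat all_nseq ltnSn orbT /=.
by apply: sub_all (IH y a.+1 Hs) => z /ltnW.
Qed.

Lemma word_sorted a p (s : seq nat) : path geq p s -> path leq a (word a p s).
Proof.
have Hn m b w : path leq b w -> path leq b (nseq m b ++ w).
  by elim: m => //= m IH /IH ->; rewrite leqnn.
have Hl b w : path leq b.+1 w -> path leq b w.
  by case: w => //= x w /andP[/ltnW -> ->].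
elim: s a p => [|x s IH] a p /=; first by move=> _; rewrite -[nseq _ _]cats0; apply: Hn.
by move=> /andP[Hx Hs]; apply/Hn/Hl/IH.
Qed.

Lemma sorted_count_eq (s1 s2 : seq nat) : sorted leq s1 -> sorted leq s2 -> size s1 = size s2 ->
  (forall j, count (fun x => (j < x)%N) s1 = count (fun x => (j < x)%N) s2) -> s1 = s2.
Proof.
move=> S1 S2 Hs Hc; apply: (sorted_eq leq_trans anti_leq S1 S2).
apply/allP => -[|j] _ /=.
  have H s : (count_mem 0%N s + count (fun x => (0 < x)%N) s = size s)%N.
    by rewrite -(count_predC (pred1 0%N)); congr addn; apply: eq_count => x /=; rewrite lt0n.
  by rewrite -(eqn_add2r (count (fun x => (0 < x)%N) s1)) H Hc H Hs.
have H s : (count_mem j.+1 s + count (fun x => (j.+1 < x)%N) s = count (fun x => (j < x)%N) s)%N.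
  elim: s => //= x s <-; rewrite addnACA; congr addn.
  by case: (ltngtP j.+1 x) => H; case: (ltnP j x) => H' //=; lia.
by rewrite -(eqn_add2r (count (fun x => (j.+1 < x)%N) s1)) H !Hc H.
Qed.

Lemma sumn_count (s : seq nat) L : (forall x, x \in s -> (x <= L)%N) ->
  sumn s = (\sum_(0 <= j < L) count (fun x => (j < x)%N) s)%N.
Proof.
elim: s => [|x s IH] H /=; first by rewrite big1.
rewrite big_split /= -IH; last by move=> y Hy; apply: H; rewrite inE Hy orbT.
congr addn; have := H x (mem_head _ _); elim: L x {IH H} => [|L IH] x HL.
  by rewrite big_geq //; lia.
rewrite big_nat_recr //=; case: (ltnP L x) => Hx; last by rewrite -IH ?addn0.
have -> : x = L.+1 by lia.
rewrite addn1 [in LHS](IH L) //; congr _.+1.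
by apply: eq_big_nat => i /andP[_ Hi]; rewrite Hi ltnS ltnW.
Qed.

Lemma mem_leq_sumn (s : seq nat) x : x \in s -> (x <= sumn s)%N.
Proof. by elim: s => //= y s IH; rewrite inE => /orP[/eqP->|/IH]; lia. Qed.

Lemma sumn_cj L mu : (sumn mu <= L)%N -> sumn (cj L mu) = sumn mu.
Proof.
move=> H; rewrite [RHS](@sumn_count _ L); last first.
  by move=> x /mem_leq_sumn; lia.
by rewrite sumnE big_map /index_iota subn0.
Qed.

(** A sorted word is determined by its length and by the number of its entries above each j;
    [count_word] and the definition of [cj] give the same numbers. *)
Lemma word_cj L N mu : is_partition mu -> (sumn mu <= L)%N -> (size mu <= N)%N ->
  word 0 N (cj L mu) = nseq (N - size mu) 0%N ++ rev mu.
Proof.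
move=> /andP[Hs H0] HL HN; have Hp := path_cj L HN.
apply: sorted_count_eq.
- exact: path_sorted (word_sorted 0 Hp).
- have : sorted leq (rev mu) by rewrite rev_sorted.
  by elim: (N - size mu)%N => //= m IH /IH; case: (_ ++ _).
- by rewrite size_word // size_cat size_nseq size_rev subnK.
move=> j; have := count_word 0 j Hp; rewrite add0n => ->.
rewrite count_cat count_nseq ltn0 mul0n add0n count_rev; case: (ltnP j L) => Hj; first by rewrite nth_mkseq.
rewrite nth_default ?size_cj //; symmetry; apply/eqP.
rewrite -leqn0 leqNgt -has_count; apply/hasPn => x /mem_leq_sumn; lia.
Qed.

Lemma rev_word_cj L N mu : is_partition mu -> (sumn mu <= L)%N -> (size mu <= N)%N ->
  rev (word 0 N (cj L mu)) = pad N mu.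
Proof.
move=> Hp HL HN; rewrite word_cj // rev_cat revK.
apply: (@eq_from_nth _ 0%N).
  by rewrite size_cat size_rev size_nseq size_mkseq subnKC.
move=> i; rewrite size_cat size_rev size_nseq subnKC // => Hi.
rewrite nth_mkseq // nth_cat; case: ltnP => // H.
by rewrite [RHS]nth_default // rev_nseq nth_nseq if_same.
Qed.

(** The partition is read off the word of [rho]: reverse it and drop the zeros. *)
Lemma parts_cj L N (rho : seq nat) : rho \in parts L N -> (sumn rho <= L)%N -> 
  exists2 mu, is_partition mu /\ sumn mu = sumn rho & (size mu <= N)%N /\ rho = cj L mu.
Proof.
rewrite mem_parts => /andP[/eqP Hs Hp] HL.
pose mu := [seq x <- rev (word 0 N rho) | (0 < x)%N].
have Hm : is_partition mu.
  rewrite /is_partition mem_filter andbT; apply: sorted_filter; first exact: geq_trans.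
  by rewrite rev_sorted; apply: path_sorted (word_sorted 0 Hp).
have Hsum : sumn mu = sumn rho.
  have H s : sumn [seq x <- s | (0 < x)%N] = sumn s by elim: s => [|[|x] s IH] //=; rewrite IH.
  by rewrite H sumn_rev sumn_word.
exists mu => //; split.
  by rewrite size_filter (leq_trans (count_size _ _)) // size_rev size_word.
apply: (@eq_from_nth _ 0%N); rewrite ?size_cj // Hs => i Hi.
rewrite nth_mkseq // -(count_word 0 i Hp) add0n /mu filter_rev count_rev count_filter.
by apply: eq_count => x /=; lia.
Qed.

Lemma cj_inj L mu mu' : is_partition mu -> is_partition mu' ->
  (sumn mu <= L)%N -> (sumn mu' <= L)%N -> cj L mu = cj L mu' -> mu = mu'.
Proof.
move=> Hp Hp' Hs Hs' E.
pose N := maxn (size mu) (size mu').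
have [HN HN'] : (size mu <= N)%N /\ (size mu' <= N)%N by rewrite /N; lia.
have := word_cj Hp Hs HN; rewrite E word_cj //.
move=> /(congr1 (filter (fun x => 0 < x)%N)); rewrite !filter_cat.
have H n : [seq x <- nseq n 0%N | (0 < x)%N] = [::] by elim: n.
have H1 m : is_partition m -> [seq x <- rev m | (0 < x)%N] = rev m.
  move=> /andP[_ H0]; apply/all_filterP/allP => x; rewrite mem_rev lt0n => Hx.
  by apply: contraNneq H0 => <-.
rewrite !H !H1 //= => /(congr1 rev); by rewrite !revK.
Qed.

Lemma sum_parts (V : nmodType) L N d (F : seq nat -> V) : (d <= L)%N ->
  \sum_(rho <- parts L N | sumn rho == d) F rho
  = \sum_(mu <- partitions d | (size mu <= N)%N) F (cj L mu).
Proof.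
move=> HL; rewrite -big_filter -[RHS]big_filter -[RHS](big_map (cj L) xpredT F).
apply/perm_big/uniq_perm.
- exact/filter_uniq/parts_uniq.
- rewrite map_inj_in_uniq; first exact/filter_uniq/partitions_uniq.
  move=> mu mu'; rewrite !mem_filter !mem_partitions.
  move=> /and3P[_ Hp /eqP Hs] /and3P[_ Hp' /eqP Hs'].
  by apply: cj_inj => //; rewrite ?Hs ?Hs'.
move=> rho; rewrite mem_filter; apply/andP/mapP => [[/eqP Hs Hr]|[mu]].
  have [|mu [Hp Hm] [HN ->]] := parts_cj Hr; first by rewrite Hs.
  by exists mu; rewrite // mem_filter HN mem_partitions Hp Hm Hs eqxx.
rewrite mem_filter mem_partitions => /and3P[HN Hp /eqP Hs] ->.
by rewrite sumn_cj Hs // cj_parts.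
Qed.

Lemma word_zeros N L : word 0 N (nseq L 0%N) = nseq N 0%N.
Proof.
by case: L => //= l; rewrite subn0 (size0nil (size_word _ _)) ?cats0 //; elim: l.
Qed.

(* The normalization v_mu(t), read off the conjugate partition s of mu in p
   variables. *)
Fixpoint mulv (R : comNzRingType) (v : nat -> R) p s : R :=
  if s is x :: s' then v (p - x)%N * mulv v x s' else v p.

(** Dividing by v turns the weight of adding a strip into that of removing it. At each entry,
    [gbin (p - x) (z - x)] has denominator v(z - x) v(p - z) and [gbin (y - z) (p - z)] has
    denominator v(p - z) v(y - p); the common v(p - z) cancels. *)
Lemma wt_mulv (R : idomainType) (t : R) (v : nat -> R) p y (s th : seq nat) :
  (forall m k, (k <= m)%N -> gbin t m k * v k * v (m - k)%N = v m) ->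
  (forall m, v m != 0) -> (p <= y)%N -> path geq p s -> th \in up p s ->
  wt t p s th * mulv v y th = wt t y (rcons th 0%N) (p :: s) * v (y - p)%N * mulv v p s.
Proof.
move=> Hg Hv; elim: s p y th => [|x s IH] p y th Hy /=.
  by rewrite inE => _ /eqP->/=; rewrite !subn0 mul1r mulr1 mulrAC Hg.
move=> /andP[Hx Hs] /allpairsPdep[z [th' [Hz Hth' ->]]] /=.
move: Hz; rewrite mem_iota => /andP[Hz1 Hz2].
have Hz : (z <= p)%N by lia.
have /= {IH}IH := IH x z th' Hz1 Hs Hth'.
have := Hg (p - x)%N (z - x)%N; have := Hg (y - z)%N (p - z)%N.
have -> : (p - x - (z - x) = p - z)%N by lia.
have -> : (y - z - (p - z) = y - p)%N by lia.
move=> H1 H2; have {}H1 := H1 (leq_sub2r _ Hy); have {}H2 := H2 (leq_sub2r _ Hz).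
apply: (mulIf (Hv (p - z)%N)).
transitivity ((gbin t (p - x) (z - x) * v (z - x)%N * v (p - z)%N) * v (y - z)%N
   * (wt t z (rcons th' 0%N) (x :: s) * mulv v x s)).
  rewrite /= mulrACA IH; ring.
by rewrite H2 -H1 /=; ring.
Qed.

(** * Hall-Littlewood symmetrizations *)

Lemma sum_perm_lift (V : nmodType) n (G : 'S_n.+1 -> V) :
  \sum_w G w = \sum_(i < n.+1) \sum_(s : 'S_n) G (lift_perm ord_max i s).
Proof.
rewrite pair_big /=.
apply: (reindex (fun p : 'I_n.+1 * 'S_n => lift_perm ord_max p.1 p.2)); apply: onW_bij.
apply: inj_card_bij.
  move=> [i s] [j s'] /= E.
  have Eij : i = j by rewrite -(lift_perm_id ord_max i s) E lift_perm_id.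
  rewrite Eij in E *; congr pair; apply/permP => k; apply: (@lift_inj _ j).
  by rewrite -!(lift_perm_lift ord_max) E.
by rewrite card_prod !card_Sn card_ord factS.
Qed.

(** Lagrange interpolation of [r] at n + 1 nodes, compared in degree n. *)
Lemma coef_interpolation (F : fieldType) n (x : 'I_n.+1 -> F) (r : {poly F}) :
  injective x -> (size r <= n.+1)%N ->
  r`_n = \sum_i r.[x i] / \prod_(j < n) (x i - x (lift i j)).
Proof.
move=> Hx Hr.
pose Q (i : 'I_n.+1) : {poly F} := \prod_(j < n) ('X - (x (lift i j))%:P).
pose D (i : 'I_n.+1) : F := \prod_(j < n) (x i - x (lift i j)).
have QD i : (Q i).[x i] = D i.
  by rewrite horner_prod; apply: eq_bigr => j _; rewrite hornerXsubC.
have D0 i : D i != 0.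
  by apply/prodf_neq0 => j _; rewrite subr_eq0 (inj_eq Hx) neq_lift.
have Q0 i k : k != i -> (Q i).[x k] = 0.
  rewrite eq_sym => /unlift_some[j -> _].
  by rewrite horner_prod (bigD1 j) //= hornerXsubC subrr mul0r.
have sQ i : size (Q i) = n.+1.
  by rewrite size_prod_XsubC /index_enum -enumT size_enum_ord.
pose p := r - \sum_i (r.[x i] / D i) *: Q i.
have p0 : p = 0.
  apply/eqP/negPn/negP => /max_poly_roots => /(_ (codom x)).
  rewrite size_codom card_ord => H.
  have /H : all (root p) (codom x).
    apply/allP => _ /codomP[k ->]; rewrite /root hornerD hornerN horner_sum.
    rewrite (bigD1 k) //= hornerZ QD divfK // big1 ?addr0 ?subrr // => i Hi.
    by rewrite hornerZ Q0 ?mulr0 // eq_sym.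
  move=> {}H; have /H : uniq (codom x) by apply/injectiveP.
  apply/negP; rewrite -leqNgt; apply: leq_trans (size_polyD _ _) _.
  rewrite geq_max Hr size_polyN; apply: leq_trans (size_sum _ _ _) _.
  by apply/bigmax_leqP => i _; apply: leq_trans (size_scale_leq _ _) _; rewrite sQ.
have -> : r = \sum_i (r.[x i] / D i) *: Q i.
  by apply/eqP; rewrite -subr_eq0 -/p p0.
rewrite coef_sum; apply: eq_bigr => i _; rewrite coefZ.
have -> : (Q i)`_n = 1.
  have := @lead_coef_prod_XsubC F _ (index_enum 'I_n) xpredT (fun j => x (lift i j)).
  by rewrite /lead_coef -/(Q i) sQ.
rewrite mulr1 horner_sum (bigD1 i) //= hornerZ QD divfK // big1 ?addr0 // => k Hk.
by rewrite hornerZ Q0 ?mulr0 // eq_sym.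
Qed.

(** The polynomial q = prod (X - t x_i) - t^(n+1) prod (X - x_i) vanishes at 0. Interpolation is
    applied to r = q / X, with top coefficient 1 - t^(n+1) and r(x_i) = (1 - t) prod_(j != i) (x_i -
    t x_j). *)
Lemma sum_prod_HL (F : fieldType) n (x : 'I_n.+1 -> F) (t : F) :
  injective x -> (forall i, x i != 0) -> t != 1 ->
  \sum_i \prod_(j < n) ((x i - t * x (lift i j)) / (x i - x (lift i j)))
  = (1 - t ^+ n.+1) / (1 - t).
Proof.
move=> Hx H0 Ht; have {}Ht : 1 - t != 0 by rewrite subr_eq0 eq_sym.
pose q : {poly F} := \prod_i ('X - (t * x i)%:P) - t ^+ n.+1 *: \prod_i ('X - (x i)%:P).
have sq : (size q <= n.+2)%N.
  apply: leq_trans (size_polyD _ _) _; rewrite size_polyN geq_max; apply/andP; split.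
    by rewrite size_prod_XsubC /index_enum -enumT size_enum_ord.
  by apply: leq_trans (size_scale_leq _ _) _; rewrite size_prod_XsubC /index_enum -enumT size_enum_ord.
have q0 : root q 0.
  rewrite /root !hornerE !horner_prod.
  under eq_bigr do rewrite hornerXsubC sub0r -mulrN.
  rewrite big_split /= prodr_const card_ord.
  under [X in _ * _ - _ * X]eq_bigr do rewrite hornerXsubC sub0r.
  by rewrite subrr.
have [r Er] : exists r, q = r * 'X.
  by move: q0 => /factor_theorem[r]; rewrite subr0; exists r.
have sr : (size r <= n.+1)%N.
  case: (eqVneq r 0) => [->|r0]; first by rewrite size_poly0.
  by rewrite -ltnS -(size_mulX r0) -Er.
have := coef_interpolation Hx sr.
have -> : r`_n = 1 - t ^+ n.+1.
  have -> : r`_n = q`_n.+1 by rewrite Er coefMX.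
  have H (f : 'I_n.+1 -> F) : (\prod_i ('X - (f i)%:P))`_n.+1 = 1.
    have := @lead_coef_prod_XsubC F _ (index_enum 'I_n.+1) xpredT f.
    by rewrite /lead_coef size_prod_XsubC /index_enum -enumT size_enum_ord.
  by rewrite coefB coefZ !H mulr1.
move=> ->; rewrite mulr_suml; apply: eq_bigr => i _.
rewrite prodf_div; apply: (mulIf Ht); rewrite mulfVK // -mulrAC; congr (_ / _).
apply: (mulfI (H0 i)).
have -> : x i * r.[x i] = q.[x i] by rewrite Er hornerMX mulrC.
rewrite /q hornerD hornerN hornerZ !horner_prod.
rewrite [X in _ - _ * X](bigD1 i) //= hornerXsubC subrr mul0r mulr0 subr0.
rewrite [RHS](bigD1_ord i) //= hornerXsubC.
under [X in _ = _ * X]eq_bigr do rewrite hornerXsubC.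
by ring.
Qed.

Definition vfact (F : fieldType) (t : F) (m : nat) : F :=
  \prod_(1 <= k < m.+1) ((1 - t ^+ k) / (1 - t)).

Lemma vfactS (F : fieldType) (t : F) m :
  vfact t m.+1 = vfact t m * ((1 - t ^+ m.+1) / (1 - t)).
Proof. by rewrite /vfact big_nat_recr. Qed.

Lemma vfact0 (F : fieldType) (t : F) : vfact t 0 = 1.
Proof. by rewrite /vfact big_geq. Qed.

Lemma vfact_neq0 (F : fieldType) (t : F) m :
  (forall k, t ^+ k.+1 != 1) -> vfact t m != 0.
Proof.
move=> H; elim: m => [|m IH]; first by rewrite vfact0 oner_neq0.
by rewrite vfactS mulf_neq0 // mulf_neq0 ?invr_eq0 // subr_eq0 eq_sym ?H // -[t]expr1.
Qed.

Lemma gbin_vfact (F : fieldType) (t : F) m k : t != 1 -> (k <= m)%N ->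
  gbin t m k * vfact t k * vfact t (m - k) = vfact t m.
Proof.
move=> Ht; have {}Ht : 1 - t != 0 by rewrite subr_eq0 eq_sym.
move=> Hk; pose phi m := vfact t m * (1 - t) ^+ m.
have H0 : phi 0%N = 1 by rewrite /phi vfact0 mulr1.
have HS j : phi j.+1 = phi j * (1 - t ^+ j.+1).
  by rewrite /phi vfactS (exprS (1 - t)); field.
have := gbin_fact H0 HS Hk; rewrite /phi => H.
apply: (mulIf (expf_neq0 m Ht)); rewrite -{}H.
have -> : (1 - t) ^+ m = (1 - t) ^+ k * (1 - t) ^+ (m - k) by rewrite -exprD subnKC.
by ring.
Qed.

Section HLsum.
Variables (F : fieldType) (t : F).

Definition HLfactor (a b : F) : F := (a - t * b) / (a - b).

(* The factors are indexed by j < i because the exponents z are meant to be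
   nondecreasing, whereas HallLittlewood has them nonincreasing. *)
Definition HLsum N (x : 'I_N -> F) (z : seq nat) : F :=
  \sum_(w : 'S_N) (\prod_(i < N) x (w i) ^+ nth 0%N z i) *
    \prod_(i < N) \prod_(j < N | (j < i)%N) HLfactor (x (w i)) (x (w j)).

(** Splitting the sum by the variable at the last position leaves the factor of [sum_prod_HL]. The
    value R_0 = v_N makes the expansion of the empty product start at P = 1. *)
Lemma HLsum0 N (x : 'I_N -> F) : injective x -> (forall i, x i != 0) -> t != 1 ->
  HLsum x (nseq N 0%N) = vfact t N.
Proof.
move=> Hx H0 Ht; rewrite /HLsum.
transitivity (\sum_(w : 'S_N) \prod_(i < N) \prod_(j < N | (j < i)%N) HLfactor (x (w i)) (x (w j))).
  apply: eq_bigr => w _; rewrite big1 ?mul1r // => i _.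
  by rewrite nth_nseq if_same.
elim: N x Hx H0 => [|N IH] x Hx H0.
  by rewrite vfact0 (big_pred1 1%g) ?big_ord0 // => s; apply/esym/eqP/permP => -[].
rewrite sum_perm_lift vfactS -(sum_prod_HL Hx H0 Ht) mulr_sumr.
apply: eq_bigr => i _; rewrite -(IH (fun j => x (lift i j))) ?mulr_suml; last first.
- by move=> j; apply: H0.
- by move=> j k /Hx /lift_inj.
apply: eq_bigr => s _; rewrite big_ord_recr /=; congr (_ * _).
  apply: eq_bigr => j _; rewrite big_mkcond big_ord_recr /= -big_mkcond /=.
  have -> : (N < j)%N = false by have := ltn_ord j; lia.
  rewrite mulr1; apply: eq_big => // k _.
  have E (l : 'I_N) : widen_ord (leqnSn N) l = lift ord_max l.
    by apply: val_inj; rewrite /= /bump leqNgt ltn_ord.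
  by rewrite !E !lift_perm_lift.
rewrite big_mkcond big_ord_recr /= ltnn mulr1 [RHS](reindex_inj (@perm_inj _ s)).
apply: eq_bigr => k _; rewrite ltn_ord lift_perm_id.
have -> : widen_ord (leqnSn N) k = lift ord_max k.
  by apply: val_inj; rewrite /= /bump leqNgt ltn_ord.
by rewrite lift_perm_lift.
Qed.
End HLsum.

Lemma sum_antisym (F : fieldType) N (s : 'S_N) (G : 'S_N -> F) :
  2%:R != 0 :> F -> (forall w, G (s * w)%g = - G w) -> \sum_w G w = 0.
Proof.
move=> H2 HG; apply/eqP; rewrite -(mulrI_eq0 _ (mulfI H2)) mulr_natl mulr2n.
rewrite {1}(reindex_inj (mulgI s)) /= -big_split /=.
by rewrite big1 // => w _; rewrite HG addNr.
Qed.

(* Against the (symmetric) rest of the summand, the pair of adjacent variables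
   (X, Y) contributes X (Y - t X) / (Y - X) - t Y (Y - t X) / (Y - X)
   = (X - t Y) (Y - t X) / (Y - X), which is antisymmetric. *)
Lemma HLsum_exchange (F : fieldType) (t : F) N (x : 'I_N -> F) u a v :
  2%:R != 0 :> F -> size (u ++ a :: a :: v) = N ->
  HLsum t x (u ++ a.+1 :: a :: v) = t * HLsum t x (u ++ a :: a.+1 :: v).
Proof.
move=> H2; rewrite size_cat /= => Hs.
have Hi0 : (size u < N)%N by lia.
have Hi1 : ((size u).+1 < N)%N by lia.
pose i0 := Ordinal Hi0; pose i1 := Ordinal Hi1.
(* The exponents common to both words: each monomial is x^b times one more variable, at position
   [i0] or [i1]. *)
pose b (i : 'I_N) := nth 0%N (u ++ a :: a :: v) i.
have E0 (i : 'I_N) : nth 0%N (u ++ a.+1 :: a :: v) i = (b i + (i == i0))%N.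
  rewrite /b !nth_cat -val_eqE /=; case: ltnP => Hi.
    by rewrite ltn_eqF ?addn0.
  have [k Ek] : exists k, (i - size u = k)%N by eexists.
  have -> : (i == size u :> nat) = (k == 0)%N by lia.
  by rewrite Ek; case: k Ek => [|k] _ /=; rewrite ?addn0 ?addn1.
have E1 (i : 'I_N) : nth 0%N (u ++ a :: a.+1 :: v) i = (b i + (i == i1))%N.
  rewrite /b !nth_cat -val_eqE /=; case: ltnP => Hi.
    by rewrite ltn_eqF ?addn0 // ltnW.
  have [k Ek] : exists k, (i - size u = k)%N by eexists.
  have -> : (i == (size u).+1 :> nat) = (k == 1)%N by lia.
  by rewrite Ek; case: k Ek => [|[|k]] _ /=; rewrite ?addn0 ?addn1.
have Eb : b i0 = b i1.
  by rewrite /b !nth_cat /= ltnn subnn ltnNge leqnSn /= subSnn.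
pose s := tperm i0 i1.
pose M w := \prod_(i < N) x ((w : 'S_N) i) ^+ b i.
have Ms w : M (s * w)%g = M w.
  rewrite /M (reindex_inj (@perm_inj _ s)) /=; apply: eq_bigr => i _.
  rewrite permM /s tpermK; congr (_ ^+ _).
  by case: tpermP => [->|->|] //; rewrite Eb.
have ME (j : 'I_N) w : \prod_(i < N) x ((w : 'S_N) i) ^+ (b i + (i == j)) = M w * x (w j).
  under eq_bigr do rewrite exprD.
  rewrite big_split /=; congr (_ * _); rewrite (bigD1 j) //= eqxx expr1.
  by rewrite big1 ?mulr1 // => i /negPf ->.
(* All pairs except the adjacent one; the transposition [s] permutes them. *)
pose P (p : 'I_N * 'I_N) := (p.2 < p.1)%N && (p != (i1, i0)).
pose Q w := \prod_(p | P p) HLfactor t (x ((w : 'S_N) p.1)) (x (w p.2)).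
have QE w : \prod_(i < N) \prod_(j < N | (j < i)%N) HLfactor t (x ((w : 'S_N) i)) (x (w j))
    = HLfactor t (x (w i1)) (x (w i0)) * Q w.
  rewrite pair_big_dep /= (bigD1 (i1, i0)) //=; congr (_ * _).
have Qs w : Q (s * w)%g = Q w.
  rewrite /Q (reindex_inj (h := fun p => (s p.1, s p.2))) /=; last first.
    by move=> [p1 p2] [q1 q2] [/perm_inj -> /perm_inj ->].
  apply: eq_big => [[p q]|[p q] _]; last by rewrite /= !permM /s !tpermK.
  have E (i j : 'I_N) : (i == j) = (i == j :> nat) by [].
  rewrite /P /= !xpair_eqE !E /s.
  case: tpermP => [->|->|/eqP + /eqP +]; case: tpermP => [->|->|/eqP + /eqP +];
    rewrite ?E /=; lia.
rewrite /HLsum mulr_sumr; apply/eqP; rewrite -subr_eq0 -sumrB; apply/eqP.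
apply: (@sum_antisym _ _ s) => // w.
under eq_bigr do rewrite E0; under [X in _ - t * (X * _)]eq_bigr do rewrite E1.
rewrite !ME !QE; under [X in - (X * _ - _)]eq_bigr do rewrite E0.
under [X in - (_ - t * (X * _))]eq_bigr do rewrite E1.
rewrite !ME Ms Qs !permM /s tpermL tpermR /HLfactor.
set X := x (w i0); set Y := x (w i1).
have -> : (X - Y)^-1 = - (Y - X)^-1 by rewrite -invrN opprB.
by ring.
Qed.

(** * The Pieri rule for symmetrizations *)

Definition elem N (F : fieldType) (x : 'I_N -> F) (r : nat) : F :=
  (\prod_(i < N) (1 + (x i)%:P * 'X))`_r.

(** The auxiliary variable X records the degree, so that one coefficient selects the subsets of a
    given size. *)
Lemma sum_inc_monomials (F : fieldType) N (c : 'I_N -> F) z : size z = N ->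
  \sum_(z' <- inc z) (\prod_(i < N) c i ^+ nth 0%N z' i)%:P * 'X^(sumn z')
  = (\prod_(i < N) c i ^+ nth 0%N z i)%:P * 'X^(sumn z) * \prod_(i < N) (1 + (c i)%:P * 'X).
Proof.
elim: z N c => [|a z IH] N c /= Hs.
  by case: N c Hs => // c _; rewrite !big_ord0 big_seq1 !big_ord0 mulr1.
case: N c Hs => // N c [Hs].
rewrite (sum_inc_cons a z (fun z' => (\prod_(i < N.+1) c i ^+ nth 0%N z' i)%:P * 'X^(sumn z'))).
rewrite [X in _ * _ * X]big_ord_recl mulrA big_ord_recl /= polyCM exprD.
rewrite [RHS](_ : _ = (c ord0 ^+ a)%:P * 'X^a * (1 + (c ord0)%:P * 'X) *
  ((\prod_(i < N) c (lift ord0 i) ^+ nth 0%N z i)%:P * 'X^(sumn z) *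
   \prod_(i < N) (1 + (c (lift ord0 i))%:P * 'X))); last by ring.
rewrite -(IH N (fun i => c (lift ord0 i)) Hs) mulrDr mulr1 mulrDl.
rewrite !mulr_sumr; congr (_ + _); apply: eq_bigr => z' _.
  by rewrite big_ord_recl /= polyCM exprD; ring.
by rewrite big_ord_recl /= !polyCM !exprD !exprS !polyCM; ring.
Qed.

(** e_r is symmetric, so in the summand of w it can be expanded in the variables permuted by w. *)
Lemma elem_HLsum (F : fieldType) (t : F) N (x : 'I_N -> F) r z : size z = N ->
  elem x r * HLsum t x z
  = \sum_(z' <- inc z | sumn z' == (sumn z + r)%N) HLsum t x z'.
Proof.
move=> Hs; rewrite /HLsum exchange_big /= mulr_sumr; apply: eq_bigr => w _.
rewrite -mulr_suml mulrA; congr (_ * _).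
have := sum_inc_monomials (fun i => x (w i)) Hs.
have -> : \prod_(i < N) (1 + (x (w i))%:P * 'X) = \prod_(i < N) (1 + (x i)%:P * 'X).
  by rewrite [RHS](reindex_inj (@perm_inj _ w)).
move=> /(congr1 (fun p : {poly F} => p`_(sumn z + r))).
rewrite -mulrA coefCM coefXnM ltnNge leq_addr addKn /= -/(elem x r) mulrC => <-.
rewrite coef_sum [RHS]big_mkcond; apply: eq_bigr => z' _.
by rewrite coefCM coefXn eq_sym; case: eqP; rewrite ?mulr1 ?mulr0.
Qed.

Lemma elem_HLsum_word (F : fieldType) (t : F) N (x : 'I_N -> F) r rho :
  2%:R != 0 :> F -> last N rho = 0%N -> path geq N rho ->
  elem x r * HLsum t x (word 0 N rho)
  = \sum_(th <- up N rho | sumn th == (sumn rho + r)%N)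
      wt t N rho th * HLsum t x (word 0 N th).
Proof.
move=> H2 Hl Hp; rewrite elem_HLsum ?size_word //.
(* Vanishing off length N and off the target degree makes the exchange rule hold for all words and
   selects the subsets of size r; an exchange preserves both conditions. *)
pose f z := if (size z == N) && (sumn z == (sumn rho + r)%N) then HLsum t x z else 0.
have Hf : exchange t f.
  move=> u a v; rewrite /f !size_cat !sumn_cat /=.
  rewrite !addSn !addnS; case: ifP => [/andP[/eqP Hs _]|_]; last by rewrite mulr0.
  by apply: HLsum_exchange; rewrite ?size_cat //=; lia.
have := sum_inc_word 0 Hf Hl Hp (leqnn N); rewrite subnn /= => H.
rewrite big_mkcond big_seq; transitivity (\sum_(z <- inc (word 0 N rho)) f z).
  rewrite [RHS]big_seq; apply: eq_bigr => z /size_inc Hz.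
  by rewrite /f Hz size_word // eqxx sumn_word.
rewrite H [RHS]big_mkcond [RHS]big_seq [LHS]big_seq; apply: eq_bigr => th Hth.
have /path_geqP Hp' : path geq N th.
  apply/path_geqP; case/upP: Hth => Hs H3; move/path_geqP: Hp => Hp.
  move=> i; case: (ltnP i (size rho)) => Hi; last by rewrite nth_default ?Hs.
  case: i Hi => [|i] Hi; first by have [] := H3 _ Hi.
  by have [_ A] := H3 _ Hi; have [B _] := H3 _ (ltnW Hi); simpl in *; lia.
have {}Hp' : path geq N th by apply/path_geqP.
by rewrite /f size_word // eqxx sumn_word //=; case: eqP; rewrite ?mulr0.
Qed.

Definition HLconj (F : fieldType) (t : F) N (x : 'I_N -> F) (rho : seq nat) : F :=
  HLsum t x (word 0 N rho) / mulv (vfact t) N rho.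

Lemma mulvE (R : comNzRingType) (v : nat -> R) p (s : seq nat) :
  mulv v p s = \prod_(0 <= i < (size s).+1) v (nth 0%N (p :: s) i - nth 0%N s i)%N.
Proof.
elim: s p => [|x s IH] p; first by rewrite big_nat1 /= subn0.
by rewrite big_nat_recl //= IH.
Qed.

Section Expansion.
Variables (F : fieldType) (t : F) (N : nat) (x : 'I_N -> F).
Hypotheses (H2 : 2%:R != 0 :> F) (Ht : forall k, t ^+ k.+1 != 1)
  (Hx : injective x) (Hx0 : forall i, x i != 0).

Let Ht1 : t != 1. Proof. by rewrite -[t]expr1 Ht. Qed.

Lemma mulv_neq0 p s : mulv (vfact t) p s != 0.
Proof.
by elim: s p => [|y s IH] p /=; rewrite ?mulf_neq0 ?vfact_neq0.
Qed.

Lemma elem_HLconj r L rho : (0 < L)%N -> rho \in parts L N -> last N rho = 0%N ->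
  elem x r * HLconj t x rho
  = \sum_(th <- up N rho | sumn th == (sumn rho + r)%N) dnwt t th rho * HLconj t x th.
Proof.
move=> HL Hr Hl; have Hp : path geq N rho by move: Hr; rewrite mem_parts => /andP[].
rewrite mulrA elem_HLsum_word // mulr_suml big_seq_cond [RHS]big_seq_cond.
apply: eq_bigr => th /andP[Hth _].
have Hg m k : (k <= m)%N -> gbin t m k * vfact t k * vfact t (m - k)%N = vfact t m.
  exact: gbin_vfact.
have := wt_mulv Hg (fun m => vfact_neq0 m Ht) (leqnn N) Hp Hth.
rewrite subnn vfact0 mulr1 => H.
have E : wt t N (rcons th 0%N) (N :: rho) = dnwt t th rho.
  case/upP: Hth => + _; rewrite mem_parts in Hr; case/andP: Hr => /eqP ->.
  by case: th {H} => [|z th] //=; [lia|rewrite gbin_full mul1r].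
apply: (mulIf (mulv_neq0 N rho)); rewrite divfK ?mulv_neq0 // -E /HLconj.
by apply: (mulIf (mulv_neq0 N th)); rewrite mulrAC H; field; exact: mulv_neq0.
Qed.

Lemma prod_elem L al : (sumn al < L)%N ->
  \prod_(r <- al) elem x r
  = \sum_(rho <- parts L N | sumn rho == sumn al) Acoef t al rho * HLconj t x rho.
Proof.
elim: al => [|r al IH] /= Hs.
  rewrite big_nil; have Hm : nseq L 0%N \in parts L N.
    by rewrite mem_parts size_nseq eqxx; elim: L N {Hs} => //= L IH N; rewrite IH.
  rewrite big_mkcond (bigD1_seq (nseq L 0%N)) ?parts_uniq //=.
  rewrite big1_seq => [|rho /andP[Hr]].
    rewrite addr0 sumn_nseq mul0n /= all_nseq orbT mul1r /HLconj.
    rewrite word_zeros HLsum0 // mulvE size_nseq big_nat_recl //= big1 => [|i _].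
      by rewrite nth_nseq if_same subn0 mulr1 divff // vfact_neq0.
    by rewrite !nth_nseq !if_same vfact0.
  rewrite mem_parts => /andP[/eqP Hsz _]; case: eqP => // H0; case/eqP: Hr.
  rewrite -Hsz; apply/all_pred1P.
  by elim: rho H0 {Hsz} => //= y rho IH H; rewrite IH ?andbT //; lia.
have {}IH := IH (leq_ltn_trans (leq_addl _ _) Hs).
rewrite big_cons IH mulr_sumr.
(* With the degree conditions inside the summand, the sum over added strips becomes one over removed
   strips, as in the recursion of [Acoef]. *)
pose f th ka := if (sumn th == r + sumn al)%N && (sumn ka + r == sumn th)%N then
  dnwt t th ka * Acoef t al ka * HLconj t x th else 0.
have HL : (0 < L)%N by lia.
transitivity (\sum_(ka <- parts L N) \sum_(th <- up N ka) f th ka).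
  rewrite big_mkcond big_seq [RHS]big_seq; apply: eq_bigr => ka Hka.
  case: eqP => Eka; last first.
    rewrite big1 // => th _; rewrite /f; case: ifP => // /andP[/eqP ? /eqP ?].
    by case: Eka; lia.
  rewrite mulrCA (@elem_HLconj _ L) //; last by apply: last_parts Hka _; rewrite Eka; lia.
  rewrite mulr_sumr big_mkcond; apply: eq_bigr => th _; rewrite /f Eka addnC.
  rewrite [(r + _ == _)%N]eq_sym andbb; case: ifP => // _; ring.
rewrite -exchange_dn_up // [RHS]big_mkcond; apply: eq_bigr => th _.
rewrite /f; case: eqP => H /=; last by rewrite big1.
by rewrite mulr_suml [RHS]big_mkcond.
Qed.
End Expansion.

(** * Agreement with the given definitions of P and s *)

Lemma sum_rev_perm (V : nmodType) N (G : ('I_N -> 'I_N) -> V) :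
  (forall f g, f =1 g -> G f = G g) ->
  \sum_(w : 'S_N) G w = \sum_(w : 'S_N) G (fun i => w (rev_ord i)).
Proof.
move=> HG; pose s : 'S_N := perm rev_ord_inj.
rewrite (reindex_inj (mulgI s)) /=; apply: eq_bigr => w _.
by apply: HG => i; rewrite permM permE.
Qed.

Lemma HallLittlewoodE (F : fieldType) (t : F) L N (x : 'I_N -> F) mu :
  is_partition mu -> (sumn mu <= L)%N -> (size mu <= N)%N ->
  HallLittlewood t x mu = HLconj t x (cj L mu).
Proof.
move=> Hp HL HN; rewrite /HallLittlewood /HLconj mulrC.
have Ew : word 0 N (cj L mu) = rev (pad N mu) by rewrite -(rev_word_cj Hp HL HN) revK.
congr (_ / _).
  rewrite /HLsum Ew (sum_rev_perm (G := fun w : 'I_N -> 'I_N =>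
    (\prod_(i < N) x (w i) ^+ nth 0%N (rev (pad N mu)) i) *
    \prod_(i < N) \prod_(j < N | (j < i)%N) HLfactor t (x (w i)) (x (w j)))); last first.
    move=> f g E; congr (_ * _); first by apply: eq_bigr => i _; rewrite E.
    by apply: eq_bigr => i _; apply: eq_bigr => j _; rewrite !E.
  apply: eq_bigr => w _; congr (_ * _).
    rewrite [LHS](reindex_inj rev_ord_inj); apply: eq_bigr => i _.
    by rewrite nth_rev ?size_mkseq //= nth_mkseq //; have := ltn_ord i; lia.
  rewrite [RHS](reindex_inj rev_ord_inj); apply: eq_bigr => i _; rewrite rev_ordK.
  rewrite [RHS](reindex_inj rev_ord_inj); apply: eq_big => j; last by rewrite rev_ordK.
  by rewrite /=; have := ltn_ord i; have := ltn_ord j; lia.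
(* No part exceeds [sumn mu], so the factors past that index are v_0 = 1. *)
rewrite mulvE size_cj (big_cat_nat (n := (sumn mu).+1)) //= [X in _ = _ * X]big_nat_cond.
have Ec j : nth 0%N (cj L mu) j = count (fun y => (j < y)%N) (pad N mu).
  have := count_word 0 j (path_cj L HN); rewrite add0n => <-.
  by rewrite Ew count_rev.
rewrite [X in _ = _ * X]big1 ?mulr1; last first.
  move=> [|i] /andP[/andP[Hi _] _] //=; rewrite !Ec.
  rewrite (_ : count _ _ = 0%N) ?sub0n ?vfact0 //; apply/eqP.
  rewrite -leqn0 leqNgt -has_count; apply/hasPn => y /mapP[k _ ->].
  case: (ltnP k (size mu)) => Hk; last by rewrite nth_default.
  rewrite -leqNgt; apply: leq_trans (mem_leq_sumn (mem_nth 0%N Hk)) _.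
  by [].
apply: eq_bigr => i _; rewrite -/(vfact t _); congr (vfact t _).
have -> : #|[set j : 'I_N | nth 0%N mu j == i]| = count_mem i (pad N mu).
  rewrite cardsE cardE size_filter /pad /mkseq -val_enum_ord -map_comp count_map.
  by rewrite enumT.
rewrite Ec; case: i => [|i] /=; rewrite ?Ec.
  rewrite -{2}(size_mkseq (nth 0%N mu) N) -/(pad N mu) -(count_predC (pred1 0%N)).
  by rewrite (@eq_count _ (predC _) (fun y => (0 < y)%N)) ?addnK // => y; rewrite /= lt0n.
apply/eqP; rewrite -(eqn_add2r (count (fun y => (i.+1 < y)%N) (pad N mu))) subnK; last first.
  by apply: sub_count => y /ltnW.
apply/eqP; elim: (pad N mu) => //= y s <-; rewrite addnACA; congr addn.
by case: (ltngtP i.+1 y) => H; case: (ltnP i y) => H' //=; lia.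
Qed.

Lemma det_vandermonde_rev (F : fieldType) N (x : 'I_N -> F) :
  \det (\matrix_(i < N, j < N) x i ^+ (N - j.+1)%N)
  = \prod_(i < N) \prod_(j < N | (i < j)%N) (x i - x j).
Proof.
pose a : 'rV[F]_N := \row_j x (rev_ord j).
pose s : 'S_N := perm rev_ord_inj.
have -> : (\matrix_(i < N, j < N) x i ^+ (N - j.+1)%N) =
    (row_perm s (col_perm s (Vandermonde N a)))^T.
  by apply/matrixP => i j; rewrite !mxE !permE /= rev_ordK.
rewrite det_tr row_permE det_mulmx det_perm col_permE det_mulmx det_perm odd_permV.
rewrite mulrCA -signr_addb addbb mulr1 det_Vandermonde.
rewrite [RHS](reindex_inj rev_ord_inj) (exchange_big_dep xpredT) //=.
apply: eq_bigr => i _; rewrite [RHS](reindex_inj rev_ord_inj) /=.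
apply: eq_big => [j|j _]; last by rewrite !mxE.
by have := ltn_ord i; have := ltn_ord j; lia.
Qed.

(** At t = 0 the numerators of the summand of w multiply to the staircase monomial permuted by w,
    and the denominators to the Vandermonde determinant up to the sign of w. What remains is the
    Leibniz expansion of the bialternant. *)
Lemma schurE (F : fieldType) L N (x : 'I_N -> F) eta : injective x ->
  is_partition eta -> (sumn eta <= L)%N -> (size eta <= N)%N ->
  schur x eta = HLconj 0 x (cj L eta).
Proof.
move=> Hx Hp HL HN; rewrite -HallLittlewoodE // /HallLittlewood /schur.
have -> : HL_norm (0 : F) N eta = 1.
  rewrite /HL_norm big1 // => i _; rewrite big_nat_cond big1 // => k /andP[/andP[Hk _] _].
  by rewrite expr0n gtn_eqF // mulr0n subr0 divr1.
rewrite invr1 mul1r det_vandermonde_rev.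
rewrite -det_tr /determinant mulr_suml; apply: eq_bigr => w _.
set V := \prod_(i < N) \prod_(j < N | (i < j)%N) (x i - x j).
have EV : \prod_(i < N) \prod_(j < N | (i < j)%N) (x (w i) - x (w j)) = (-1) ^+ w * V.
  rewrite -det_vandermonde_rev /V -det_vandermonde_rev -det_perm -det_mulmx -row_permE.
  by congr (\det _); apply/matrixP => i j; rewrite !mxE.
have V0 : V != 0.
  apply/prodf_neq0 => i _; apply/prodf_neq0 => j Hij; rewrite subr_eq0 (inj_eq Hx).
  by apply: contraTneq Hij => ->; rewrite ltnn.
under [X in _ = _ * X]eq_bigr do rewrite prodf_div.
rewrite prodf_div EV invfM invr_sign.
have -> : \prod_(i < N) \prod_(j < N | (i < j)%N) (x (w i) - 0 * x (w j))
    = \prod_(i < N) x (w i) ^+ (N - i.+1).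
  apply: eq_bigr => i _; under eq_bigr do rewrite mul0r subr0.
  by rewrite -prodr_const_nat (big_geq_mkord i.+1 N xpredT (fun=> x (w i))).
have E (a b c d : F) : c * (a * b) / d = a * (b * (c * d^-1)) by ring.
rewrite -E; congr (_ * _ / _).
by rewrite -big_split /=; apply: eq_bigr => i _; rewrite !mxE exprD.
Qed.

(** * Independence of the Schur polynomials *)

Definition qembed N : {rmorphism {poly int} -> ratfun N} :=
  (@tofrac {mpoly {poly int}[N]} \o @mpolyC N {poly int}).

Lemma qcoefE N c : qcoef N c = qembed N c. Proof. by []. Qed.

Lemma qembed_inj N : injective (qembed N).
Proof. by move=> a b /eqP; rewrite /= tofrac_eq mpolyC_eq => /eqP. Qed.

Lemma ratfun_two_neq0 N : 2%:R != 0 :> ratfun N.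
Proof.
rewrite -(rmorph_nat (qembed N)) -(rmorph0 (qembed N)) (inj_eq (@qembed_inj N)).
by rewrite -(rmorph_nat (@polyC int)) polyC_eq0.
Qed.

Lemma polyX_expS_neq1 k : 'X ^+ k.+1 != 1 :> {poly int}.
Proof. by apply/eqP => /(congr1 (fun p : {poly int} => size p)); rewrite size_polyXn size_poly1. Qed.

Lemma qembedX_neq1 N k : qembed N 'X ^+ k.+1 != 1.
Proof.
by rewrite -rmorphXn -(rmorph1 (qembed N)) (inj_eq (@qembed_inj N)) polyX_expS_neq1.
Qed.

Lemma xvar_inj N : injective (@xvar N).
Proof.
move=> i j /eqP; rewrite /xvar tofrac_eq => /eqP/(congr1 (mcoeff U_(i))).
by rewrite !mcoeffXU eqxx; case: eqP => // _ /eqP; rewrite mulr0n oner_eq0.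
Qed.

Lemma xvar_neq0 N i : @xvar N i != 0.
Proof.
rewrite /xvar tofrac_eq0; apply/eqP => /(congr1 (mcoeff U_(i))).
by rewrite mcoeffXU eqxx mcoeff0 => /eqP; rewrite oner_eq0.
Qed.

Lemma pad_inj N (mu la : seq nat) : is_partition mu -> is_partition la ->
  (size mu <= N)%N -> (size la <= N)%N -> pad N mu = pad N la -> mu = la.
Proof.
have H m : is_partition m -> (size m <= N)%N -> [seq x <- pad N m | (0 < x)%N] = m.
  move=> Hp Hs; rewrite -(rev_word_cj Hp (leqnn _) Hs) word_cj // rev_cat revK filter_cat.
  have -> : forall k, [seq x <- rev (nseq k 0%N) | (0 < x)%N] = [::].
    by move=> k; rewrite rev_nseq; elim: k.
  rewrite cats0; apply/all_filterP/allP => x Hx; rewrite lt0n.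
  by case/andP: Hp => _; apply: contraNneq => <-.
by move=> Hm Hl Sm Sl E; rewrite -(H mu) // E H.
Qed.

(* The exponents mu + (N-1, .., 1, 0) are strictly decreasing, so no nontrivial
   permutation of them is again of this form. *)
Section Staircase.
Variables (N : nat).
Let e (mu : seq nat) (i : nat) : nat := (nth 0 mu i + (N - i.+1))%N.

Lemma staircase_perm (mu la : seq nat) (w : 'S_N) : sorted geq mu -> sorted geq la ->
  (forall i : 'I_N, e mu (w i) = e la i) -> w = 1%g /\ pad N mu = pad N la.
Proof.
move=> Hm Hl E.
have S nu : sorted geq nu -> sorted gtn (mkseq (e nu) N).
  move=> Hn; apply/(sortedP 0%N) => i; rewrite size_mkseq => Hi.
  rewrite !nth_mkseq // ?(ltnW Hi) // /e /=.
  by have := sorted_geq_nth i Hn; lia.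
have EE : mkseq (e mu) N = mkseq (e la) N.
  have gt_trans : transitive gtn by move=> a b c /= H1 H2; apply: ltn_trans H2 H1.
  apply: (irr_sorted_eq (leT := gtn)) => //; [by move=> i /=; rewrite ltnn|exact: S|exact: S|].
  have I nu : mkseq (e nu) N = [seq e nu (nat_of_ord i) | i <- enum 'I_N].
    by rewrite /mkseq -val_enum_ord -map_comp.
  move=> y; rewrite !I; apply/mapP/mapP => -[i _ ->].
    by exists ((w^-1)%g i); rewrite ?mem_enum // -E permKV.
  by exists (w i); rewrite ?mem_enum // E.
have En (i : nat) : (i < N)%N -> e mu i = e la i.
  by move=> Hi; rewrite -(nth_mkseq 0%N (e mu) Hi) EE nth_mkseq.
split.
  apply/permP => i; rewrite perm1; apply: val_inj => /=.
  have : e mu (w i) = e mu i by rewrite E En.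
  have Hd : forall a b : nat, (a < b)%N -> (b < N)%N -> (e mu b < e mu a)%N.
    move=> a b; elim: b => // b IH; rewrite ltnS leq_eqVlt => H Hb.
    have : (e mu b.+1 < e mu b)%N by rewrite /e; have := sorted_geq_nth b Hm; lia.
    case/orP: H => [/eqP-> //|/IH]; have := ltnW Hb; lia.
  case: (ltngtP (w i) i) => // H; first by have := Hd _ _ H (ltn_ord i); lia.
  by have := Hd _ _ H (ltn_ord _); lia.
apply/(@eq_from_nth _ 0%N); rewrite !size_mkseq // => i Hi; rewrite !nth_mkseq //.
by have := En i Hi; rewrite /e; lia.
Qed.
End Staircase.

(** Once the Vandermonde denominator is cleared, take the coefficient of x^(la + delta), delta =
    (N-1, .., 0): over all the determinants, only the diagonal term of that of [la] has this
    exponent. *)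
Lemma schur_free d N (c : seq nat -> {poly int}) : (d <= N)%N ->
  \sum_(mu <- partitions d) qembed N (c mu) * schur (@xvar N) mu = 0 ->
  forall mu, mu \in partitions d -> c mu = 0.
Proof.
move=> Hd H la Hla.
pose e (mu : seq nat) (i : nat) := (nth 0 mu i + (N - i.+1))%N.
pose M mu : 'M[{mpoly {poly int}[N]}]_N := \matrix_(i < N, j < N) 'X_i ^+ e mu j.
have DM mu : \det (\matrix_(i < N, j < N) @xvar N i ^+ (nth 0%N mu j + (N - j.+1))%N)
    = tofrac (\det (M mu)).
  rewrite -det_map_mx; congr (\det _); apply/matrixP => i j.
  by rewrite !mxE rmorphXn.
pose V := \det (\matrix_(i < N, j < N) @xvar N i ^+ (N - j.+1)%N).
have V0 : V != 0.
  rewrite /V det_vandermonde_rev; apply/prodf_neq0 => i _; apply/prodf_neq0 => j Hij.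
  rewrite subr_eq0 (inj_eq (@xvar_inj N)).
  by apply: contraTneq Hij => ->; rewrite ltnn.
have {}H : \sum_(mu <- partitions d) (c mu)%:MP_[N] * \det (M mu) = 0.
  apply/eqP; rewrite -tofrac_eq0 rmorph_sum /=; apply/eqP.
  rewrite -[RHS](mul0r V) -[in RHS]H mulr_suml; apply: eq_bigr => mu _.
  by rewrite rmorphM /schur DM -/V -mulrA divfK.
have S mu : mu \in partitions d -> [/\ is_partition mu, sorted geq mu & (size mu <= N)%N].
  rewrite mem_partitions => /andP[Hp /eqP Hs]; split=> //; first by case/andP: Hp.
  apply: leq_trans Hd; rewrite -Hs; case/andP: Hp => _.
  elim: mu {Hs} => //= x mu IH; rewrite inE negb_or => /andP[Hx /IH]; lia.
pose m := [multinom e la i | i < N].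
move: H => /(congr1 (mcoeff m)); rewrite mcoeff0 raddf_sum /=.
rewrite (bigD1_seq la) ?partitions_uniq //=.
have Hc mu : mu \in partitions d -> ((c mu)%:MP_[N] * \det (M mu))@_m = c mu *+ (mu == la).
  move=> Hmu; have [Pm Sm Nm] := S mu Hmu; have [Pl Sl Nl] := S la Hla.
  rewrite mcoeffCM -det_tr raddf_sum /= mulr_sumr (bigD1 1%g) //= [X in _ + X]big1 => [|w Hw].
    rewrite odd_perm1 expr0 mul1r addr0.
    under eq_bigr do rewrite !mxE perm1.
    have -> : \prod_(i < N) 'X_i ^+ e mu i = 'X_[[multinom e mu i | i < N]] :> {mpoly {poly int}[N]}.
      by rewrite mpolyXE_id; apply: eq_bigr => i _; rewrite mnmE.
    rewrite mcoeffX /m; case: (eqVneq mu la) => [->|Hne]; first by rewrite eqxx mulr1.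
    case: eqP => [/mnmP E|]; last by rewrite mulr0.
    have [|_ /pad_inj E2] := @staircase_perm N mu la 1%g Sm Sl.
      by move=> i; rewrite perm1; have := E i; rewrite !mnmE.
    by case/eqP: Hne; apply: E2.
  under eq_bigr do rewrite !mxE.
  have -> : \prod_(i < N) 'X_(w i) ^+ e mu i
      = 'X_[[multinom e mu ((w^-1)%g i) | i < N]] :> {mpoly {poly int}[N]}.
    rewrite mpolyXE_id [RHS](reindex_inj (@perm_inj _ w)).
    by apply: eq_bigr => i _; rewrite mnmE permK.
  rewrite mulr_sign; suff E0 : ('X_[[multinom e mu ((w^-1)%g i) | i < N]] : {mpoly {poly int}[N]})@_m = 0.
    by case: ifP => _; rewrite ?mcoeffN E0 ?oppr0 mulr0.
  rewrite mcoeffX; case: eqP => // /mnmP E.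
  have [|E2 _] := @staircase_perm N mu la (w^-1)%g Sm Sl.
    by move=> i; have := E i; rewrite !mnmE.
  by case/eqP: Hw; rewrite -[w]invgK E2 invg1.
have -> : \sum_(mu <- partitions d | mu != la) ((c mu)%:MP_[N] * \det (M mu))@_m = 0.
  by apply: big1_seq => mu /andP[Hne Hmu]; rewrite (Hc mu Hmu) (negPf Hne).
by rewrite addr0 (Hc la Hla) eqxx mulr1n.
Qed.

(** * Kostka-Foulkes polynomials from the Pieri coefficients *)

Lemma sum_neq0 (V : nmodType) (T : eqType) (s : seq T) (P : pred T) (f : T -> V) :
  \sum_(x <- s | P x) f x != 0 -> exists2 x, x \in s & P x && (f x != 0).
Proof.
move=> H; suff /hasP[x] : has (fun x => P x && (f x != 0)) s by exists x.
apply: contraNT H; rewrite -all_predC => /allP H; rewrite big1_seq // => x /andP[Px /H].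
by rewrite /= Px /= negbK => /eqP.
Qed.

Definition psum (i : nat) (s : seq nat) : nat := (\sum_(0 <= j < i) nth 0 s j)%N.

Lemma psumS i s : psum i.+1 s = (psum i s + nth 0 s i)%N.
Proof. by rewrite /psum big_nat_recr. Qed.

Lemma psum_take i s : psum i s = sumn (take i s).
Proof.
elim: s i => [|x s IH] i; first by rewrite /psum big1 // => j _; rewrite nth_nil.
case: i => [|i]; first by rewrite /psum big_geq.
by rewrite /psum big_nat_recl //= -IH.
Qed.

Lemma psum_all i s : (forall j, (i <= j)%N -> nth 0 s j = 0%N) -> psum i s = sumn s.
Proof.
move=> H; rewrite psum_take -[in RHS](cat_take_drop i s) sumn_cat.
rewrite [X in (_ + X)%N](_ : _ = 0%N) ?addn0 //.
apply/eqP; rewrite (sumnE (drop i s)) big1_seq // => x /andP[_ /(nthP 0%N)[j _ <-]].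
by rewrite nth_drop H // leq_addr.
Qed.

Lemma leq_psum i (s s' : seq nat) :
  (forall j, (nth 0 s j <= nth 0 s' j)%N) -> (psum i s <= psum i s')%N.
Proof. by move=> H; apply: leq_sum => j _. Qed.

Lemma eq_leq_sumn (s s' : seq nat) : size s = size s' ->
  (forall j, (nth 0 s j <= nth 0 s' j)%N) -> sumn s = sumn s' -> s = s'.
Proof.
elim: s s' => [|x s IH] [|y s'] //= [Hs] H.
have Hxy := H 0%N; have Hss := fun j => H j.+1; rewrite /= in Hxy Hss.
have := leq_psum (size s) Hss; rewrite !psum_all => [|j|j]; last 2 first.
- by move=> Hj; rewrite nth_default -?Hs.
- by move=> Hj; rewrite nth_default -?Hs.
move=> H1 H2; have -> : x = y by lia.
by rewrite (IH s') //; lia.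
Qed.

Lemma nth_pad_ge L s i : (size s <= L)%N -> nth 0%N (pad L s) i = nth 0%N s i.
Proof.
move=> Hs; case: (ltnP i L) => Hi; first by rewrite nth_mkseq.
by rewrite !nth_default ?size_mkseq // (leq_trans Hs).
Qed.

Lemma sumn_pad L s : (size s <= L)%N -> sumn (pad L s) = sumn s.
Proof.
move=> Hs; rewrite -(@psum_all L) => [|j Hj]; last by rewrite nth_default ?size_mkseq.
rewrite -[in RHS](@psum_all L) => [|j Hj]; last by rewrite nth_default // (leq_trans Hs).
by apply: eq_bigr => j _; rewrite nth_pad_ge.
Qed.

(** A nonzero coefficient comes from a chain of strips. Each adds at most one row, so the i
    innermost ones, whose sizes are the last i entries of [al], fill a shape inside [rho] with at
    most i rows. *)
Lemma Acoef_supp (R : comNzRingType) (t : R) al (rho : seq nat) :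
  (0 < size rho)%N -> Acoef t al rho != 0 ->
  [/\ sumn rho = sumn al, (forall i, (size al <= i)%N -> nth 0 rho i = 0%N)
    & forall i, (sumn (drop (size al - i) al) <= psum i rho)%N].
Proof.
elim: al rho => [|r al IH] rho HL /=.
  case: (boolP (all _ _)) => [/all_pred1P E _|_]; last by rewrite mulr0n eqxx.
  by split=> [|i _|i]; rewrite // E ?sumn_nseq ?nth_nseq ?if_same.
case/sum_neq0 => nu /(dnP _ HL)[Hs H] /andP[/eqP Hr H0].
have HA : Acoef t al nu != 0 by apply: contraNneq H0 => ->; rewrite mulr0.
rewrite -Hs in HL; have [S1 S2 S3] := IH nu HL HA.
have S0 i : ((size al).+1 <= i)%N -> nth 0%N rho i = 0%N.
  case: i => // i; rewrite ltnS => /S2 Hi; have [] := H i.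
  by rewrite Hi leqn0 => /eqP.
split=> [||i]; [by lia|exact: S0|].
case: (leqP i (size al)) => Hi.
  rewrite subSn //=; apply: leq_trans (S3 i) _.
  by apply: leq_psum => j; have [] := H j.
have -> : ((size al).+1 - i = 0)%N by lia.
rewrite drop0 /= psum_all; first by lia.
by move=> j Hj; apply: S0; lia.
Qed.

Lemma wt_at0 (R : comNzRingType) p s th : th \in up p s -> wt (0 : R) p s th = 1.
Proof.
elim: s p th => [|x s IH] p th //= /allpairsPdep[y [z [Hy Hz ->]]].
by rewrite IH // gbin_at0 ?mulr1 //; move: Hy; rewrite mem_iota; lia.
Qed.

Lemma dnwt_at0 (R : comNzRingType) rho nu : nu \in dn rho -> dnwt (0 : R) rho nu = 1.
Proof. exact: wt_at0. Qed.

(** The only chain adds the rows of [pi] one at a time: before the last strip the row bound of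
    [Acoef_supp] leaves room only in the earlier rows, and the degree forces them to be full. *)
Lemma Acoef_diag (R : comNzRingType) L pi : (0 < L)%N -> sorted geq pi -> (size pi <= L)%N ->
  Acoef (0 : R) (rev pi) (pad L pi) = 1.
Proof.
move=> HL; elim/last_ind: pi => [|pi r IH].
  move=> _ _; rewrite /rev /= /pad /mkseq all_map (_ : all _ _ = true) //.
  by apply/allP => i _ /=; rewrite nth_nil.
rewrite size_rcons => Hs Hsz; have Hs' : sorted geq pi.
  by move: Hs; rewrite -cats1 => /cat_sorted2[].
have Hpn i : nth 0%N (pad L pi) i = nth 0%N pi i by rewrite nth_pad_ge // ltnW.
have Hpr i : nth 0%N (pad L (rcons pi r)) i = nth 0%N (rcons pi r) i.
  by rewrite nth_pad_ge // size_rcons.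
have Hle i : (nth 0 pi i <= nth 0 (rcons pi r) i)%N.
  by rewrite nth_rcons; case: ltnP => // Hi; rewrite nth_default.
have Hd : pad L pi \in dn (pad L (rcons pi r)).
  apply/dnP; rewrite !size_mkseq //; split=> // i; rewrite Hpn !Hpr; split=> //.
  case: (ltnP i (size pi)) => Hi.
    have := sorted_geq_nth i Hs; by rewrite [X in (_ <= X)%N]nth_rcons Hi.
  by rewrite nth_default // size_rcons ltnS.
rewrite rev_rcons /= big_mkcond (bigD1_seq (pad L pi)) ?dn_uniq //=.
rewrite !sumn_pad ?size_rcons ?(ltnW Hsz) // sumn_rcons eqxx dnwt_at0 //.
rewrite mul1r IH // ?(ltnW Hsz) // big1_seq ?addr0 // => nu /andP[Hne Hnu].
case: eqP => // Hsum; case: (eqVneq (Acoef 0 (rev pi) nu) (0 : R)) => [->|]; first by rewrite mulr0.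
move: Hnu => /dnP; rewrite size_mkseq => /(_ HL)[Hz Hnu].
case/Acoef_supp; rewrite ?Hz // => Hsm H0 _; case/eqP: Hne.
apply: eq_leq_sumn => [|j|]; rewrite ?size_mkseq //.
  rewrite Hpn; case: (ltnP j (size pi)) => Hj; last by rewrite H0 ?size_rev.
  by have [_] := Hnu j; rewrite Hpr nth_rcons Hj.
by rewrite Hsm sumn_rev sumn_pad // ltnW.
Qed.

Lemma size_partition mu : is_partition mu -> (size mu <= sumn mu)%N.
Proof.
case/andP=> _; elim: mu => //= x mu IH; rewrite inE negb_or => /andP[Hx /IH].
by move: Hx; lia.
Qed.

Lemma head_leq_sumn (mu : seq nat) : (head 0 mu <= sumn mu)%N.
Proof. by case: mu => //= x mu; rewrite leq_addr. Qed.

Lemma size_conj_part mu : size (conj_part mu) = head 0%N mu.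
Proof. by rewrite size_map size_iota. Qed.

Lemma sumn_conj_part mu : is_partition mu -> sumn (conj_part mu) = sumn mu.
Proof.
move=> Hp; have H := head_leq_sumn mu.
by rewrite -(@sumn_pad (sumn mu)) ?size_conj_part // pad_conj // sumn_cj.
Qed.

Lemma conj_partP mu : is_partition mu -> is_partition (conj_part mu).
Proof.
move=> Hp; have Hh := head_leq_sumn mu.
have /path_geqP H := path_cj (sumn mu) (leqnn (size mu)).
apply/andP; split.
  apply/(sortedP 0%N) => i; rewrite size_conj_part => Hi /=.
  have E j : nth 0%N (conj_part mu) j = nth 0%N (cj (sumn mu) mu) j.
    by rewrite -pad_conj // nth_pad_ge // size_conj_part.
  by rewrite !E; apply: (H i.+1).
apply/mapP => -[j]; rewrite mem_iota => /andP[_ Hj] /esym/eqP.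
rewrite -leqn0 leqNgt -has_count => /hasPn; case: mu Hj {Hp Hh H} => //= x mu Hj.
by move=> /(_ x); rewrite mem_head => /(_ isT); rewrite Hj.
Qed.

Lemma conj_part_partitions d mu : mu \in partitions d -> conj_part mu \in partitions d.
Proof.
by rewrite !mem_partitions => /andP[Hp /eqP <-]; rewrite conj_partP // sumn_conj_part ?eqxx.
Qed.

Lemma partitionsE d mu : mu \in partitions d ->
  [/\ is_partition mu, sumn mu = d & (size mu <= d)%N].
Proof.
rewrite mem_partitions => /andP[Hp /eqP <-]; split=> //; exact: size_partition.
Qed.

(** [Acoef_supp] compares all partial sums; if the totals agreed, every partial sum would, and [rho]
    would be [pi]. *)
Lemma dominance_psum L (pi rho : seq nat) : is_partition pi -> is_partition rho ->
  (size pi <= L)%N -> (size rho <= L)%N -> (0 < L)%N ->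
  Acoef (0 : int) (rev pi) (pad L rho) != 0 -> rho != pi ->
  (\sum_(i < L.+1) psum i pi < \sum_(i < L.+1) psum i rho)%N.
Proof.
move=> Hpi Hrho Spi Srho HL HA; case/Acoef_supp: HA; rewrite ?size_mkseq // => _ _ H.
have {}H i : (psum i pi <= psum i rho)%N.
  have := H i; rewrite drop_rev size_rev sumn_rev.
  have -> : psum i (pad L rho) = psum i rho.
    by apply: eq_bigr => j _; rewrite nth_pad_ge.
  apply: leq_trans; case: (leqP i (size pi)) => Hi; first by rewrite subKn // psum_take.
  have -> : (size pi - i = 0)%N by lia.
  rewrite subn0 take_size psum_all // => j Hj.
  by rewrite nth_default // (leq_trans (ltnW Hi)).
move=> Hne; rewrite ltnNge; apply: contra_neqN Hne => Hle.
have [_] := leqif_sum (P := xpredT) (fun i _ => leqif_eq (H (i : 'I_L.+1))).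
rewrite eqn_leq Hle leq_sum //= => /esym/forall_inP E.
apply: (@pad_inj L) => //; apply: (@eq_from_nth _ 0%N); rewrite !size_mkseq // => i Hi.
rewrite !nth_pad_ge //.
have /(_ isT)/eqP E1 := E (Ordinal (ltnW Hi : i < L.+1)%N).
have /(_ isT)/eqP /= := E (Ordinal (Hi : i.+1 < L.+1)%N).
by rewrite !psumS /= in E1 *; move: E1; simpl; lia.
Qed.

(* Unitriangularity of the Kostka matrix for the dominance order; the sum of
   the partial sums of a partition is a strictly increasing numerical rank. *)
Lemma Kostka_inverse d L : (d < L)%N -> exists D : seq nat -> seq nat -> int,
  forall pi rho, pi \in partitions d -> rho \in partitions d ->
  \sum_(al <- partitions d) D pi al * Acoef 0 (rev al) (pad L rho) = (rho == pi)%:R.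
Proof.
move=> HL; pose rank (pi : seq nat) := (\sum_(i < L.+1) psum i pi)%N.
have Hrank pi : pi \in partitions d -> (rank pi <= L.+1 * d)%N.
  move=> /partitionsE[_ <- _]; rewrite -[L.+1 in X in (_ <= X)%N]card_ord -sum_nat_const.
  apply: leq_sum => i _; rewrite psum_take -[in X in (_ <= X)%N](cat_take_drop i pi) sumn_cat.
  exact: leq_addr.
(* Descending induction on the rank, which is at most (L + 1) d: stage k treats the partitions of
   rank above (L + 1) d - k. *)
suff /(_ (L.+1 * d).+1)[D HD] : forall k, exists D : seq nat -> seq nat -> int,
    forall pi rho, pi \in partitions d -> rho \in partitions d ->
    (L.+1 * d < rank pi + k)%N ->
    \sum_(al <- partitions d) D pi al * Acoef 0 (rev al) (pad L rho) = (rho == pi)%:R.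
  by exists D => pi rho Hpi Hrho; apply: HD => //; lia.
elim=> [|k [D HD]].
  by exists (fun _ _ => 0) => pi rho /Hrank H1 _; rewrite addn0 ltnNge H1.
(* Back-substitution: row [pi] of the inverse is the unit vector minus a combination of other rows,
   and a nonzero coefficient occurs only for strictly larger rank, where the induction applies. *)
exists (fun pi al => (al == pi)%:R -
  \sum_(pi' <- partitions d | pi' != pi) Acoef 0 (rev pi) (pad L pi') * D pi' al).
move=> pi rho Hpi Hrho Hk.
under eq_bigr do rewrite mulrBl; rewrite sumrB.
rewrite (bigD1_seq pi) ?partitions_uniq //= eqxx mul1r [X in _ + X - _]big1 ?addr0; last first.
  by move=> al /negPf ->; rewrite mul0r.
under eq_bigr do rewrite mulr_suml; rewrite exchange_big /=.
have S mu : mu \in partitions d -> [/\ is_partition mu, sorted geq mu & (size mu <= L)%N].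
  move=> /partitionsE[Hp Hs Hz]; split => //; first by case/andP: Hp.
  exact: leq_trans Hz (ltnW HL).
have HL0 : (0 < L)%N by lia.
have [Ppi Spi Zpi] := S pi Hpi; have [Prho Srho Zrho] := S rho Hrho.
rewrite [X in _ - X](_ : _ =
    \sum_(pi' <- partitions d | pi' != pi) Acoef 0 (rev pi) (pad L pi') * (rho == pi')%:R).
  case: (eqVneq rho pi) => [->|Hne].
    rewrite Acoef_diag // big1 ?subr0 // => pi' Hpi'.
    by rewrite eq_sym (negPf Hpi') mulr0.
  rewrite big_mkcond (bigD1_seq rho) ?partitions_uniq //= Hne eqxx mulr1.
  rewrite big1 ?addr0 ?subrr // => pi' Hpi'.
  by rewrite [rho == _]eq_sym (negPf Hpi') mulr0 if_same.
rewrite big_seq_cond [RHS]big_seq_cond; apply: eq_bigr => pi' /andP[Hpi' Hne].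
under eq_bigr do rewrite -mulrA; rewrite -mulr_sumr.
have [Ppi' Spi' Zpi'] := S pi' Hpi'.
case: (eqVneq (Acoef 0 (rev pi) (pad L pi')) (0 : int)) => [->|HA]; first by rewrite !mul0r.
rewrite HD //; have := dominance_psum Ppi Ppi' Zpi Zpi' HL0 HA Hne; rewrite -!/(rank _).
by move: Hk; clear; lia.
Qed.

Lemma Acoef_inverse d L : (d < L)%N -> exists D : seq nat -> seq nat -> int,
  forall eta mu, eta \in partitions d -> mu \in partitions d ->
  \sum_(al <- partitions d) D eta al * Acoef 0 (rev al) (cj L mu) = (mu == eta)%:R.
Proof.
move=> HL; have [D HD] := Kostka_inverse HL.
exists (fun eta => D (conj_part eta)) => eta mu Heta Hmu.
have [Pe Se _] := partitionsE Heta; have [Pm Sm _] := partitionsE Hmu.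
rewrite -pad_conj // HD ?conj_part_partitions //; congr (nat_of_bool _)%:R.
apply/eqP/eqP => [E|-> //]; apply: (@cj_inj L); rewrite ?Se ?Sm ?(ltnW HL) //.
by rewrite -!pad_conj // E.
Qed.

Section Expansions.
Variable N : nat.
Let x := @xvar N.
Let q : ratfun N := qembed N 'X.

Lemma prod_elem_HL d L al : (d < L)%N -> sumn al = d ->
  \prod_(r <- al) elem x r = \sum_(mu <- partitions d | (size mu <= N)%N)
     qembed N (Acoef 'X al (cj L mu)) * HallLittlewood q x mu.
Proof.
move=> HL Hal; rewrite (@prod_elem _ q _ _ _ _ _ _ L) ?Hal //.
- rewrite sum_parts ?(ltnW HL) // big_seq_cond [RHS]big_seq_cond.
  apply: eq_bigr => mu /andP[/partitionsE[Hp Hs _] Hz].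
  by rewrite rmorph_Acoef (@HallLittlewoodE _ _ L) // Hs ltnW.
- exact: ratfun_two_neq0.
- exact: qembedX_neq1.
- exact: xvar_inj.
- exact: xvar_neq0.
Qed.

Lemma prod_elem_schur d L al : (d < L)%N -> sumn al = d ->
  \prod_(r <- al) elem x r = \sum_(mu <- partitions d | (size mu <= N)%N)
     qembed N (Acoef (0 : int) al (cj L mu))%:P * schur x mu.
Proof.
move=> HL Hal; rewrite (@prod_elem _ (0 : ratfun N) _ _ _ _ _ _ L) ?Hal //.
- rewrite sum_parts ?(ltnW HL) // big_seq_cond [RHS]big_seq_cond.
  apply: eq_bigr => mu /andP[/partitionsE[Hp Hs _] Hz].
  rewrite (@schurE _ L) ?Hs ?(ltnW HL) //; last exact: xvar_inj.
  by rewrite !rmorph_Acoef !rmorph0.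
- exact: ratfun_two_neq0.
- by move=> k; rewrite expr0n eq_sym oner_neq0.
- exact: xvar_inj.
- exact: xvar_neq0.
Qed.
End Expansions.

(** A row of A(0)^-1 combines the products of the e_r into s_eta by the expansion at t = 0; the
    expansion at t = q then writes s_eta in the P_mu. Integrality of A(0)^-1 keeps the coefficients
    in Z[q]. The value at q = 0 is recorded for [HallLittlewood_free]. *)
Lemma KostkaFoulkes_exists : exists K, is_KostkaFoulkes K /\
  forall d eta mu, eta \in partitions d -> mu \in partitions d ->
    (K eta mu).[0] = (mu == eta)%:R.
Proof.
pose D d := proj1_sig (ClassicalEpsilon.constructive_indefinite_description _
  (Acoef_inverse (ltnSn d))).
have HD d := proj2_sig (ClassicalEpsilon.constructive_indefinite_description _
  (Acoef_inverse (ltnSn d))); rewrite -/(D _) in HD.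
exists (fun eta mu => \sum_(al <- partitions (sumn eta))
  (D (sumn eta) eta al)%:P * Acoef 'X (rev al) (cj (sumn eta).+1 mu)).
split=> [N eta Hp HN|d eta mu Heta Hmu]; last first.
  have [Pe Se _] := partitionsE Heta; rewrite Se -(HD _ _ _ Heta Hmu).
  rewrite horner_sum; apply: eq_bigr => al _; rewrite hornerM hornerC; congr (_ * _).
  have := rmorph_Acoef (horner_eval (0 : int)) 'X (rev al) (cj d.+1 mu).
  by rewrite /= /horner_eval hornerX.
set d := sumn eta; have Heta : eta \in partitions d by rewrite mem_partitions Hp eqxx.
transitivity (\sum_(al <- partitions d) qembed N (D d eta al)%:P *
    \prod_(r <- rev al) elem (@xvar N) r).
  rewrite big_seq; under eq_bigr => al /partitionsE[_ Hal _].
    rewrite (@prod_elem_schur N d d.+1) ?sumn_rev // mulr_sumr; over.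
  rewrite -big_seq exchange_big /= (eq_bigr (fun mu =>
      qembed N (\sum_(al <- partitions d) D d eta al * Acoef 0 (rev al) (cj d.+1 mu))%:P
      * schur (@xvar N) mu)); last first.
    move=> mu _; rewrite !rmorph_sum mulr_suml; apply: eq_bigr => al _.
    by rewrite mulrA -!rmorphM.
  rewrite big_seq_cond (eq_bigr (fun mu => (mu == eta)%:R * schur (@xvar N) mu)).
    rewrite -big_seq_cond big_mkcond (bigD1_seq eta) ?partitions_uniq //= HN eqxx mul1r.
    by rewrite big1 ?addr0 // => mu /negPf ->; rewrite mul0r if_same.
  by move=> mu /andP[Hmu _]; rewrite (HD _ _ _ Heta Hmu) !rmorph_nat.
rewrite big_seq; under eq_bigr => al /partitionsE[_ Hal _].
  rewrite (@prod_elem_HL N d d.+1) ?sumn_rev // mulr_sumr; over.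
rewrite -big_seq exchange_big /=; apply: eq_bigr => mu _.
rewrite !qcoefE rmorph_sum mulr_suml; apply: eq_bigr => al _.
by rewrite mulrA -!rmorphM.
Qed.

(** The matrix K(q) has determinant 1 at q = 0, hence a nonzero determinant. Its adjugate turns a
    relation among the P_mu, multiplied by det K, into one among the s_eta without any division. *)
Lemma HallLittlewood_free d N (c : seq nat -> {poly int}) : (d <= N)%N ->
  \sum_(mu <- partitions d) qembed N (c mu) * HallLittlewood (qembed N 'X) (@xvar N) mu = 0 ->
  forall mu, mu \in partitions d -> c mu = 0.
Proof.
move=> HN H0; have [K [HK HK0]] := KostkaFoulkes_exists.
pose s := partitions d; pose m := size s; pose P (i : 'I_m) := nth [::] s i.
have Ps i : P i \in s by apply: mem_nth.
have sumP (V : nmodType) (f : seq nat -> V) : \sum_(mu <- s) f mu = \sum_(i < m) f (P i).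
  by rewrite (big_nth [::]) big_mkord.
pose M : 'M[{poly int}]_m := \matrix_(i, j) K (P i) (P j).
have detM : \det M != 0.
  apply/eqP => /(congr1 (horner_eval (0 : int))); rewrite -det_map_mx.
  rewrite (_ : map_mx _ _ = 1%:M) ?det1 ?rmorph0; first by move/eqP; rewrite oner_eq0.
  apply/matrixP => i j; rewrite !mxE -[LHS]/((K (P i) (P j)).[0]) (HK0 d) // eq_sym /P.
  by rewrite nth_uniq ?partitions_uniq.
pose h i := HallLittlewood (qembed N 'X) (@xvar N) (P i).
have HS i : schur (@xvar N) (P i) = \sum_j qembed N (M i j) * h j.
  have [Pe Se Ze] := partitionsE (Ps i).
  rewrite HK // ?(leq_trans Ze) // Se big_mkcond -/s sumP; apply: eq_bigr => j _.
  have [_ _ Zj] := partitionsE (Ps j).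
  by rewrite (leq_trans Zj HN) qcoefE /h mxE.
pose cv : 'rV[{poly int}]_m := \row_i c (P i).
pose e := cv *m \adj M.
have He : e = 0.
  pose c' mu := \sum_(i < m) e 0 i *+ (mu == P i).
  have Hc' i : c' (P i) = e 0 i.
    rewrite /c' (bigD1 i) //= eqxx mulr1n big1 ?addr0 // => j Hj.
    by rewrite nth_uniq ?partitions_uniq // eq_sym (inj_eq val_inj) (negPf Hj).
  apply/rowP => i; rewrite [RHS]mxE -Hc'; apply: (schur_free HN) => //; rewrite -/s sumP.
  under eq_bigr do rewrite Hc' HS mulr_sumr.
  rewrite exchange_big /=.
  transitivity (qembed N (\det M) * \sum_(j < m) qembed N (c (P j)) * h j); last first.
    by rewrite -(sumP _ (fun mu => qembed N (c mu) * HallLittlewood (qembed N 'X) (@xvar N) mu)) H0 mulr0.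
  rewrite mulr_sumr; apply: eq_bigr => j _.
  under eq_bigr do rewrite mulrA -(rmorphM (qembed N)).
  have Ej : \sum_i e 0 i * M i j = \det M * c (P j).
    have -> : \sum_i e 0 i * M i j = (e *m M) 0 j by rewrite mxE.
    by rewrite /e -mulmxA mul_adj_mx mul_mx_scalar !mxE.
  by rewrite -mulr_suml -(rmorph_sum (qembed N)) Ej (rmorphM (qembed N)) mulrA.
move=> mu Hmu; have Hi : (index mu s < m)%N by rewrite index_mem.
have : (e *m M) 0 (Ordinal Hi) = 0 by rewrite He mul0mx mxE.
rewrite /e -mulmxA mul_adj_mx mul_mx_scalar !mxE /P /= nth_index // => /eqP.
by rewrite mulf_eq0 (negPf detM) => /eqP.
Qed.

Lemma KostkaFoulkesP : is_KostkaFoulkes KostkaFoulkes.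
Proof.
have [K [HK _]] := KostkaFoulkes_exists.
by apply: (ClassicalEpsilon.epsilon_spec _ is_KostkaFoulkes); exists K.
Qed.

(** The product of the e_r does not depend on the order of its factors, and in d variables the P_mu
    with |mu| = d are independent. *)
Lemma Acoef_perm d L al al' mu : (d < L)%N -> sumn al = d -> perm_eq al al' ->
  mu \in partitions d -> Acoef ('X : {poly int}) al (cj L mu) = Acoef 'X al' (cj L mu).
Proof.
move=> HL Hal Hperm Hmu; apply/eqP; rewrite -subr_eq0; apply/eqP; move: mu Hmu.
have Hal' : sumn al' = d by rewrite -Hal; apply/esym/perm_sumn.
apply: (@HallLittlewood_free d d) => //.
have := prod_elem_HL d HL Hal; rewrite (perm_big _ Hperm) (prod_elem_HL d HL Hal') => /eqP.
rewrite eq_sym -subr_eq0 -sumrB => /eqP H; rewrite -[RHS]H [RHS]big_mkcond big_seq [RHS]big_seq.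
apply: eq_bigr => mu /partitionsE[_ _ ->]; by rewrite rmorphB mulrBl.
Qed.

Lemma Acoef_KostkaFoulkes d L al mu : (d < L)%N -> sumn al = d -> mu \in partitions d ->
  Acoef ('X : {poly int}) al (cj L mu)
  = \sum_(eta <- partitions d) (Acoef (0 : int) al (cj L eta))%:P * KostkaFoulkes eta mu.
Proof.
move=> HL Hal Hmu; apply/eqP; rewrite -subr_eq0; apply/eqP; move: mu Hmu.
apply: (@HallLittlewood_free d d) => //.
have := prod_elem_HL d HL Hal; rewrite (prod_elem_schur d HL Hal) => /eqP.
rewrite eq_sym -subr_eq0 => /eqP H; rewrite -[RHS]H.
rewrite (eq_bigr (fun mu => qembed d (Acoef 'X al (cj L mu)) *
   HallLittlewood (qembed d 'X) (@xvar d) mu - \sum_(eta <- partitions d)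
   qembed d (Acoef (0 : int) al (cj L eta))%:P * (qembed d (KostkaFoulkes eta mu) *
   HallLittlewood (qembed d 'X) (@xvar d) mu))); last first.
  move=> mu _; rewrite rmorphB mulrBl; congr (_ - _).
  by rewrite rmorph_sum mulr_suml; apply: eq_bigr => eta _; rewrite rmorphM mulrA.
rewrite sumrB; congr (_ - _).
  rewrite [RHS]big_mkcond big_seq [RHS]big_seq.
  by apply: eq_bigr => mu /partitionsE[_ _ ->].
rewrite exchange_big [RHS]big_mkcond big_seq [RHS]big_seq.
apply: eq_bigr => eta /partitionsE[Hp Hs Hz]; rewrite Hz -mulr_sumr; congr (_ * _).
rewrite KostkaFoulkesP // Hs [RHS]big_mkcond big_seq [RHS]big_seq.
by apply: eq_bigr => mu /partitionsE[_ _ ->].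
Qed.

(** * The dual RSK identity *)

Lemma mem_up_cons pp s1 sg z1 (z : seq nat) :
  (z1 :: z \in up pp (s1 :: sg)) = [&& (s1 <= z1)%N, (z1 <= pp)%N & z \in up s1 sg].
Proof.
apply/allpairsPdep/and3P => [[y [th [Hy Hth [-> ->]]]]|[H1 H2 Hz]].
  by move: Hy; rewrite mem_iota => Hy; split=> //; lia.
by exists z1, z; split=> //; rewrite mem_iota; lia.
Qed.

Lemma sum_iota_eq (V : nmodType) x n s (c : V) :
  \sum_(y <- iota x n) (if y == s then c else 0) = if (x <= s < x + n)%N then c else 0.
Proof.
rewrite -mem_iota; case: (boolP (s \in _)) => Hs.
  rewrite (bigD1_seq s) ?iota_uniq //= eqxx big1 ?addr0 // => y /negPf -> //.
by rewrite big1_seq // => y /andP[_ Hy]; case: eqP Hs => // <-; rewrite Hy.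
Qed.

Lemma mem_inc_leq (w z : seq nat) : z \in inc w ->
  (sumn w <= sumn z)%N /\ forall i, (nth 0 w i <= nth 0 z i <= (nth 0 w i).+1)%N.
Proof.
elim: w z => [|a w IH] z /=; first by rewrite inE => /eqP->; split=> // -[].
rewrite mem_cat => /orP[] /mapP[y /IH[Hs H] ->] /=; split; try lia;
  by case=> [|i] /=; rewrite ?H //; lia.
Qed.

Lemma sum_iota_eqS (V : nmodType) x n s (c : V) :
  \sum_(y <- iota x n) (if y.+1 == s then c else 0) = if (x < s <= x + n)%N then c else 0.
Proof.
rewrite -(@sum_iota_eq _ x.+1 n) -[x.+1]add1n iotaDl big_map.
by apply: eq_bigr.
Qed.

(* For fixed tau and sg both sides factor over the rows; the
   factor of row i on the left depends on sg_(i-1), sg_i, tau_i and on the right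
   on sg_i, tau_i, tau_(i+1), and they differ by the ratio
   beta (sg_(i-1), tau_i) / beta (sg_i, tau_(i+1)). *)
Lemma strip_commutation_aux pp p (tau sg : seq nat) :
  path geq p tau -> path geq pp sg -> size sg = (size tau).+1 -> last pp sg = 0%N ->
  \sum_(z <- inc (p :: tau) | z \in up pp sg) 'X^(sumn z) =
  ((p <= pp)%:R + (p < pp)%:R * 'X) *
  \sum_(pi <- up p (rcons tau 0%N)) \sum_(z <- inc pi | z == sg)
    'X^(p + sumn tau + (sumn sg - sumn pi)) :> {poly int}.
Proof.
have F1 q (w v : seq nat) s1 r : \sum_(z <- inc (q :: w) | z \in up r (s1 :: v)) 'X^(sumn z)
    = (((s1 <= q <= r)%N)%:R * 'X^q + ((s1 <= q.+1 <= r)%N)%:R * 'X^(q.+1)) *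
      \sum_(z <- inc w | z \in up s1 v) 'X^(sumn z) :> {poly int}.
  rewrite big_mkcond (sum_inc_cons q w) mulrDl; congr (_ + _);
    rewrite [in RHS]big_mkcond mulr_sumr; apply: eq_bigr => z _;
    rewrite mem_up_cons andbA; case: (s1 <= _ <= r)%N; rewrite /= ?mul0r ?mul1r // exprD;
    by case: ifP; rewrite ?mulr0.
elim: tau pp p sg => [|x tau IH] pp p [|s1 sg] //.
  case: sg => // _ _ _ H0; have {H0}-> : s1 = 0%N := H0.
  rewrite F1 big_mkcond big_seq1 inE eqxx expr0 mulr1 !leq0n !andTb.
  have -> : \sum_(pi <- up p [:: 0%N]) \sum_(z <- inc pi | z == [:: 0%N])
      'X^(p + 0 + (0 + 0 - sumn pi)) = 'X^p :> {poly int}.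
    rewrite big_up // big_nat_recl // big_seq1 [X in _ + X]big1 => [|i _].
      by rewrite !add0n !addn0 big_mkcond /= big_cons big_seq1 /= !addr0.
    by rewrite add0n /= big_seq1 big_mkcond /= big_cons big_seq1 /= addr0.
  by rewrite mulrDl -mulrA -exprS.
move=> /andP[Hx Hp] /andP[Hs1 Hsg] [Hsz] Hl.
rewrite F1 (IH s1 x sg) // mulrA.
(* The first row on the right: an entry y with x <= y <= p, kept or raised by one, must become
   [s1]. *)
have G1 : \sum_(pi <- up p (x :: rcons tau 0%N)) \sum_(z <- inc pi | z == s1 :: sg)
      'X^(p + (x + sumn tau) + (s1 + sumn sg - sumn pi))
   = (((x <= s1 <= p)%N)%:R * 'X^p + ((x < s1 <= p.+1)%N)%:R * 'X^(p.+1)) *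
     \sum_(pi <- up x (rcons tau 0%N)) \sum_(z <- inc pi | z == sg)
      'X^(x + sumn tau + (sumn sg - sumn pi)) :> {poly int}.
  set K := \sum_(pi <- up x _) _.
  rewrite [LHS]big_allpairs_dep mulrDl.
  transitivity (\sum_(y <- iota x (p.+1 - x)) ((if y == s1 then 'X^p * K else 0) +
      (if y.+1 == s1 then 'X^(p.+1) * K else 0))).
    apply: eq_bigr => y _.
    transitivity (\sum_(th <- up x (rcons tau 0%N)) \sum_(z <- inc th | z == sg)
       ((if y == s1 then 'X^p * 'X^(x + sumn tau + (sumn sg - sumn th)) else 0) +
        (if y.+1 == s1 then 'X^(p.+1) * 'X^(x + sumn tau + (sumn sg - sumn th)) else 0))
        : {poly int}).
      apply: eq_bigr => th _; rewrite big_mkcond (sum_inc_cons y th).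
      rewrite -big_split [RHS]big_mkcond big_seq [RHS]big_seq; apply: eq_bigr => z.
      move=> /mem_inc_leq[Hz _]; rewrite !eqseq_cons.
      case: (z =P sg) => [Ez|_]; rewrite /= ?andbF ?addr0 ?andbT //.
      rewrite Ez in Hz; congr (_ + _); case: eqP => // <-; rewrite -exprD; congr (_ ^+ _); rewrite /=; lia.
    rewrite /K; case: (y == s1); case: (y.+1 == s1); cbv iota; rewrite ?addr0 ?add0r.
    - by rewrite -mulrDl mulr_sumr; apply: eq_bigr => th _; rewrite mulr_sumr; apply: eq_bigr => z _; rewrite mulrDl.
    - by rewrite mulr_sumr; apply: eq_bigr => th _; rewrite mulr_sumr; apply: eq_bigr => z _; rewrite addr0.
    - by rewrite mulr_sumr; apply: eq_bigr => th _; rewrite mulr_sumr; apply: eq_bigr => z _; rewrite add0r.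
    by rewrite big1 // => th _; rewrite big1 // => z _; rewrite addr0.
  rewrite big_split sum_iota_eq sum_iota_eqS subnKC ?(leqW Hx) //= ltnS.
  by congr (_ + _); case: ifP; rewrite ?mul1r ?mul0r.
rewrite rcons_cons [RHS](congr1 _ G1) mulrA; congr (_ * _).
have {}Hx : (x <= p)%N := Hx; have {}Hs1 : (s1 <= pp)%N := Hs1; clear -Hx Hs1.
have X1 : 'X^(p.+1) = 'X^p * 'X :> {poly int} by rewrite exprSr.
(* The identity of one row: with beta(r, a) = [a <= r] + [a < r] X, the left factor times beta(s1,
   x) is beta(pp, p) times the right factor. *)
have [H1|[H1|H1]] : (p < pp \/ pp < p \/ p = pp)%N by lia.
- have [H2|[H2|H2]] : (s1 < p.+1 \/ p.+1 < s1 \/ s1 = p.+1)%N by lia.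
  + have [-> -> -> ->] : [/\ (s1 <= p <= pp)%N = true, (s1 <= p.+1 <= pp)%N = true,
      (x <= s1 <= p)%N = (x <= s1)%N & (x < s1 <= p.+1)%N = (x < s1)%N] by split; lia.
    have [-> ->] : (p <= pp)%N = true /\ (p < pp)%N = true by split; lia.
    by rewrite X1 !mulr1n !mul1r; ring.
  + have [-> -> -> ->] : [/\ (s1 <= p <= pp)%N = false, (s1 <= p.+1 <= pp)%N = false,
      (x <= s1 <= p)%N = false & (x < s1 <= p.+1)%N = false] by split; lia.
    by rewrite !mulr0n !mul0r addr0 mul0r mulr0.
  have [-> -> -> ->] : [/\ (s1 <= p <= pp)%N = false, (s1 <= p.+1 <= pp)%N = true,
    (x <= s1 <= p)%N = false & (x < s1 <= p.+1)%N = true] by split; lia.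
  have [-> -> -> ->] : [/\ (x <= s1)%N = true, (x < s1)%N = true, (p <= pp)%N = true
    & (p < pp)%N = true] by split; lia.
  by rewrite !mulr0n !mulr1n !mul0r !add0r !mul1r mulrC.
- have [-> -> -> ->] : [/\ (s1 <= p <= pp)%N = false, (s1 <= p.+1 <= pp)%N = false,
    (p <= pp)%N = false & (p < pp)%N = false] by split; lia.
  by rewrite !mulr0n !mul0r addr0 !mul0r.
have [-> -> -> ->] : [/\ (s1 <= p <= pp)%N = true, (s1 <= p.+1 <= pp)%N = false,
  (x <= s1 <= p)%N = (x <= s1)%N & (x < s1 <= p.+1)%N = (x < s1)%N] by split; lia.
have [-> ->] : (p <= pp)%N = true /\ (p < pp)%N = false by split; lia.
by rewrite X1 !mulr0n !mulr1n !mul0r !addr0 !mul1r; ring.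
Qed.

Arguments parts : simpl never.

(** A first row is raised at most from p to p + 1, so the bound p + 1 does not constrain it. The
    boundary factor is then 1 + X, whose two terms give the two sizes on the right. *)
Lemma strip_commutation s p (tau sg : seq nat) :
  path geq p tau -> path geq p.+1 sg -> size sg = (size tau).+1 -> last p.+1 sg = 0%N ->
  \sum_(z <- inc (p :: tau) | z \in up p.+1 sg) (sumn z == sumn sg + s)%N%:R =
  \sum_(pi <- dn (p :: tau)) \sum_(z <- inc pi | z == sg)
    ((sumn pi + s == p + sumn tau)%N%:R + (sumn pi + s == (p + sumn tau).+1)%N%:R) :> int.
Proof.
move=> Hp Hs Hz Hl; have := strip_commutation_aux Hp Hs Hz Hl.
move=> /(congr1 (fun P : {poly int} => P`_(sumn sg + s))).
rewrite leqnSn ltnSn !mul1r mulrDl mul1r coefD coefXM coef_sum => H.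
transitivity (\sum_(z <- inc (p :: tau) | z \in up p.+1 sg)
    ('X^(sumn z) : {poly int})`_(sumn sg + s)).
  by apply: eq_bigr => z _; rewrite coefXn eq_sym.
rewrite {}H; set G := \sum_(pi <- _) _.
have HG k : G`_k = \sum_(pi <- dn (p :: tau)) \sum_(z <- inc pi | z == sg)
    (k == p + sumn tau + (sumn sg - sumn pi))%N%:R.
  rewrite coef_sum; apply: eq_bigr => pi _; rewrite coef_sum; apply: eq_bigr => z _.
  by rewrite coefXn.
have HG' : (if (sumn sg + s == 0)%N then 0 else G`_(sumn sg + s).-1) =
    \sum_(pi <- dn (p :: tau)) \sum_(z <- inc pi | z == sg)
    (sumn sg + s == (p + sumn tau + (sumn sg - sumn pi)).+1)%N%:R.
  case: eqP => E.
    by rewrite E big1 // => pi _; rewrite big1.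
  rewrite HG; apply: eq_bigr => pi _; apply: eq_bigr => z _.
  by congr (nat_of_bool _)%:R; lia.
rewrite HG' HG -big_split; apply: eq_bigr => pi _ /=.
rewrite -big_split big_seq_cond [RHS]big_seq_cond; apply: eq_bigr => z.
move=> /andP[/mem_inc_leq[Hle _] /eqP Ez]; rewrite Ez in Hle.
by congr ((nat_of_bool _)%:R + (nat_of_bool _)%:R); lia.
Qed.

Lemma sum_inc_zero (R : comNzRingType) w :
  \sum_(z <- inc w) (all (pred1 0%N) z)%:R = (all (pred1 0%N) w)%:R :> R.
Proof.
elim: w => [|a w IH]; first by rewrite /= big_seq1.
rewrite (sum_inc_cons a w (fun z => (all (pred1 0%N) z)%:R)) /=.
rewrite [X in _ + X]big1 ?addr0 //; case: (a == 0)%N; rewrite /= ?IH //.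
by rewrite big1.
Qed.

Lemma mem_parts_sorted L N (z : seq nat) : (0 < L)%N -> size z = L -> (nth 0 z 0 <= N)%N ->
  (z \in parts L N) = sorted geq z.
Proof.
move=> HL Hz HN; rewrite mem_parts Hz eqxx /=; case: z Hz HN => [E|x z _ /= ->//].
by move: HL; rewrite -E.
Qed.

Lemma sum_dn_parts (V : nmodType) L N z (P : pred (seq nat)) (f : seq nat -> V) : (0 < L)%N ->
  z \in parts L N ->
  \sum_(sg <- dn z | P sg) f sg = \sum_(sg <- parts L N | (z \in up N sg) && P sg) f sg.
Proof.
move=> HL Hz; rewrite big_mkcond (@sum_sub _ _ (dn z) (parts L N)) ?dn_uniq ?parts_uniq //.
  rewrite -big_mkcondr big_seq_cond [RHS]big_seq_cond; apply: eq_bigl => sg.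
  case: (boolP (sg \in parts L N)) => //= Hsg; congr (_ && _).
  by apply/idP/idP => [/(dn_parts HL Hz)[]|/(up_parts HL Hsg)[]].
by move=> sg /(dn_parts HL Hz)[].
Qed.

Notation kostka := (Acoef (0 : int)).

Lemma kostka_dn r al tau :
  kostka (r :: al) tau = \sum_(nu <- dn tau | sumn nu + r == sumn tau) kostka al nu.
Proof.
rewrite /= big_seq_cond [RHS]big_seq_cond; apply: eq_bigr => nu /andP[H _].
by rewrite dnwt_at0 ?mul1r.
Qed.

(* The Pieri rule for the combinatorial Schur polynomial
   sum_al kostka al tau y^al, coefficient by coefficient. *)
Lemma kostka_inc al (tau : seq nat) : sorted geq tau -> (size al < size tau)%N ->
  \sum_(z <- inc tau | sorted geq z) kostka al z = \sum_(al' <- dec al) kostka al' tau.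
Proof.
elim: al tau => [|s la IH] tau Ht Hz.
  rewrite big_seq1 -[RHS]/((all (pred1 0%N) tau)%:R : int) -sum_inc_zero big_mkcond.
  apply: eq_bigr => z _; rewrite -[kostka _ z]/((all (pred1 0%N) z)%:R : int).
  case: ifPn => // Hs; case: (boolP (all _ _)) => // /all_pred1P E; case/negP: Hs.
  by rewrite E; elim: (size z) => //= n; case: n.
case: tau Ht Hz => // p tau Ht Hz; pose L := (size tau).+1; pose N := p.+1.
have HL : (0 < L)%N by [].
pose c (pi : seq nat) : int :=
  (sumn pi + s == p + sumn tau)%N%:R + (sumn pi + s == (p + sumn tau).+1)%N%:R.
have Hinc z : z \in inc (p :: tau) -> size z = L /\ (nth 0 z 0 <= N)%N.
  by move=> H; rewrite (size_inc H); have [_ /(_ 0%N)/andP[]] := mem_inc_leq H.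
have LHS1 : \sum_(z <- inc (p :: tau) | sorted geq z) kostka (s :: la) z =
    \sum_(z <- inc (p :: tau)) \sum_(sg <- parts L N | (z \in up N sg) && (sumn sg + s == sumn z)%N)
      kostka la sg.
  rewrite big_mkcond big_seq [RHS]big_seq; apply: eq_bigr => z /Hinc[Hz1 Hz2].
  rewrite -(mem_parts_sorted HL Hz1 Hz2); case: ifPn => Hzp.
    by rewrite kostka_dn (sum_dn_parts _ _ HL Hzp).
  rewrite big_seq_cond big1 // => sg /andP[Hsg /andP[Hup _]].
  by case/negP: Hzp; have [] := up_parts HL Hsg Hup.
rewrite {}LHS1.
under eq_bigr do rewrite big_mkcond.
rewrite exchange_big /=.
have dnL pi : pi \in dn (p :: tau) -> [/\ size pi = L, sorted geq pi & (nth 0 pi 0 <= p)%N].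
  have Htp : p :: tau \in parts L p by rewrite mem_parts /= eqxx leqnn.
  move=> H; have [+ _] := dn_parts HL Htp H; rewrite mem_parts => /andP[/eqP-> Hpi].
  by move/path_geqP: (Hpi) => /(_ 0%N) ?; split=> //; exact: path_sorted Hpi.
transitivity (\sum_(sg <- parts L N) \sum_(pi <- dn (p :: tau)) \sum_(z <- inc pi | z == sg)
    c pi * kostka la sg).
  rewrite big_seq [RHS]big_seq; apply: eq_bigr => sg Hsg; rewrite -big_mkcond /=.
  rewrite [RHS](eq_bigr (fun pi => (\sum_(z <- inc pi | z == sg) c pi) * kostka la sg)); last first.
    by move=> pi _; rewrite mulr_suml.
  (* A shape with nonzero coefficient has at most [size la] rows, so its last entry is zero, as
     [strip_commutation] requires. *)
  rewrite -mulr_suml; case: (eqVneq (kostka la sg) 0) => [->|Hk].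
    by rewrite mulr0 big1.
  have : sg \in parts L N by exact: Hsg.
  rewrite mem_parts => /andP[/eqP Hsz Hp].
  rewrite -strip_commutation //; last first.
    have [|_ H0 _] := Acoef_supp _ Hk; first by rewrite Hsz.
    rewrite (last_nth 0%N) Hsz /=; apply: H0; exact: (@ltnW (size la) (size tau) Hz).
  rewrite mulr_suml big_mkcondr; apply: eq_bigr => z _; rewrite [(sumn z == _)%N]eq_sym.
  by case: eqP; rewrite ?mul0r ?mul1r.
rewrite exchange_big /=.
transitivity (\sum_(pi <- dn (p :: tau)) c pi * \sum_(al' <- dec la) kostka al' pi).
  rewrite big_seq [RHS]big_seq; apply: eq_bigr => pi /dnL[Hs1 Hs2 Hs3].
  rewrite -IH //; last by rewrite Hs1; exact: ltnW Hz.
  rewrite mulr_sumr; under eq_bigr do rewrite big_mkcond.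
  rewrite exchange_big /= [RHS]big_mkcond big_seq [RHS]big_seq; apply: eq_bigr => z Hzi.
  have [_ /(_ 0%N)/andP[_ H0]] := mem_inc_leq Hzi.
  have Hzs : size z = L by rewrite (size_inc Hzi).
  rewrite -(@mem_parts_sorted L N) //; last by rewrite (leq_trans H0).
  case: (boolP (z \in _)) => Hzp.
    rewrite (bigD1_seq z) ?parts_uniq //= eqxx big1 ?addr0 // => sg.
    by rewrite eq_sym => /negPf ->.
  by rewrite big1_seq // => sg /andP[_ Hsg]; case: eqP Hzp => // ->; rewrite Hsg.
rewrite [LHS](eq_bigr (fun pi => \sum_(al' <- dec la) c pi * kostka al' pi)); last first.
  by move=> pi _; rewrite mulr_sumr.
rewrite exchange_big /= big_cat big_map.
have E (k : nat) : \sum_(l <- dec la) kostka (k :: l) (p :: tau) =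
    \sum_(l <- dec la) \sum_(pi <- dn (p :: tau)) (sumn pi + k == p + sumn tau)%N%:R * kostka l pi.
  apply: eq_bigr => l _; rewrite kostka_dn big_mkcond; apply: eq_bigr => pi _.
  by case: eqP; rewrite ?mul0r ?mul1r.
rewrite E; transitivity (\sum_(l <- dec la) (\sum_(pi <- dn (p :: tau)) (sumn pi + s == p + sumn tau)%N%:R * kostka l pi
   + \sum_(pi <- dn (p :: tau)) (sumn pi + s == (p + sumn tau).+1)%N%:R * kostka l pi)).
  by apply: eq_bigr => l _; rewrite -big_split; apply: eq_bigr => pi _; rewrite /c mulrDl.
(* The two terms of [c] are the two branches of [dec]: [s] kept or lowered. For s = 0 nothing can be
   lowered, and the second term would need a [pi] larger than the shape containing it. *)
rewrite big_split; congr (_ + _); case: s {c Hz} => [|s].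
  rewrite big_nil big1 // => l _; rewrite big1_seq // => pi /andP[_ Hpi].
  have Hle : (sumn pi <= p + sumn tau)%N.
    have [Hs1 _ _] := dnL _ Hpi; have := @leq_psum L pi (p :: tau).
    rewrite !psum_all; [|by move=> j Hj; rewrite nth_default|by move=> j Hj; rewrite nth_default ?Hs1].
    by apply=> j; case/dnP: Hpi => // _ /(_ j)[].
  by case: eqP => [|_]; rewrite ?mul0r //; lia.
rewrite big_map E; apply: eq_bigr => l _; apply: eq_bigr => pi _.
by rewrite addnS eqSS.
Qed.

Lemma sum_inc_cat (V : nmodType) w1 w2 (f : seq nat -> V) :
  \sum_(z <- inc (w1 ++ w2)) f z = \sum_(z1 <- inc w1) \sum_(z2 <- inc w2) f (z1 ++ z2).
Proof.
elim: w1 f => [|a w1 IH] f; first by rewrite big_seq1.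
by rewrite cat_cons !sum_inc_cons !IH.
Qed.

Lemma sum_inc_rev (V : nmodType) w (f : seq nat -> V) :
  \sum_(z <- inc (rev w)) f z = \sum_(z <- inc w) f (rev z).
Proof.
elim: w f => [|a w IH] f; first by rewrite !big_seq1.
rewrite sum_inc_cons rev_cons -cats1 sum_inc_cat -big_split IH.
apply: eq_bigr => z _; rewrite (sum_inc_cons a [::] (fun z2 => f (rev z ++ z2))) !big_seq1.
by rewrite !rev_cons !cats1.
Qed.

(** Symmetry of the Kostka numbers in the content is [Acoef_perm] at q = 0; if the degree does not
    match, both sides vanish. *)
Lemma kostka_perm L (al al' tau : seq nat) : (sumn al < L)%N -> perm_eq al al' ->
  size tau = L -> sorted geq tau -> kostka al tau = kostka al' tau.
Proof.
move=> HL Hp Hs Ht; have HL0 : (0 < size tau)%N by rewrite Hs; lia.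
case: (eqVneq (sumn tau) (sumn al)) => E; last first.
  have H0 a : sumn a = sumn al -> kostka a tau = 0.
    move=> Ea; apply/eqP; apply: contraNT E => H.
    by have [-> _ _] := Acoef_supp HL0 H; rewrite Ea.
  by rewrite !H0 //; apply/esym/perm_sumn.
have Htp : tau \in parts L (head 0%N tau).
  by rewrite mem_parts Hs eqxx /=; case: tau Ht {Hs HL0 E} => //= x tau ->; rewrite leqnn.
have [|mu [Hmu Emu] [_ ->]] := parts_cj Htp; first by rewrite E ltnW.
have Hmu' : mu \in partitions (sumn al) by rewrite mem_partitions Hmu Emu E eqxx.
have := Acoef_perm HL (erefl _) Hp Hmu'.
move=> /(congr1 (horner_eval (0 : int))).
by rewrite !(rmorph_Acoef (horner_eval (0 : int))) /= /horner_eval hornerX.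
Qed.

(** [rev (word 0 L ka)] is the conjugate of [ka], so this counts pairs of tableaux of conjugate
    shapes with contents [nu] and [al]. *)
Definition dual_pairs (L : nat) (nu al : seq nat) : int :=
  \sum_(ka <- parts L L) kostka nu ka * kostka al (rev (word 0 L ka)).

Lemma dual_pairs_perm L nu al al' : (sumn al < L)%N -> perm_eq al al' ->
  dual_pairs L nu al = dual_pairs L nu al'.
Proof.
move=> HL Hp; rewrite /dual_pairs big_seq [RHS]big_seq; apply: eq_bigr => ka.
rewrite mem_parts => /andP[_ Hka]; congr (_ * _); apply: (kostka_perm HL Hp).
  by rewrite size_rev size_word.
by rewrite rev_sorted; exact: path_sorted (word_sorted 0 Hka).
Qed.

Lemma dual_pairs_neq0 L nu al : (0 < L)%N -> dual_pairs L nu al != 0 -> sumn al = sumn nu.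
Proof.
move=> HL /sum_neq0[ka + /andP[_ H]]; rewrite mem_parts => /andP[/eqP Hs Hp].
have H1 : kostka nu ka != 0 by apply: contraNneq H => ->; rewrite mul0r.
have H2 : kostka al (rev (word 0 L ka)) != 0 by apply: contraNneq H => ->; rewrite mulr0.
have [|E1 _ _] := Acoef_supp _ H1; first by rewrite Hs.
have [|E2 _ _] := Acoef_supp _ H2; first by rewrite size_rev size_word.
by rewrite -E1 -E2 sumn_rev sumn_word.
Qed.

(** Extended by zero to unsorted words, Kostka numbers satisfy the exchange rule at t = 0. So
    [sum_inc_word] turns horizontal strips added to [ka] into vertical strips added to its
    conjugate, where [kostka_inc] applies. *)
Lemma sum_up_kostka L al ka : (size al < L)%N -> ka \in parts L L -> last L ka = 0%N ->
  \sum_(th <- up L ka) kostka al (rev (word 0 L th)) =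
  \sum_(al' <- dec al) kostka al' (rev (word 0 L ka)).
Proof.
move=> Hal; have HL : (0 < L)%N by lia.
move=> Hka Hl; move: (Hka); rewrite mem_parts => /andP[_ Hp].
pose f z := if sorted leq z then kostka al (rev z) else 0.
have Hf : exchange (0 : int) f.
  move=> u a v; rewrite mul0r /f; case: ifP => // Hs.
  suff : sorted leq (a.+1 :: a :: v) by rewrite /= ltnn.
  by move/cat_sorted2: Hs => [].
have := sum_inc_word 0 Hf Hl Hp (leqnn L); rewrite subnn => H.
transitivity (\sum_(th <- up L ka) wt 0 L ka th * f (word 0 L th)).
  rewrite big_seq [RHS]big_seq; apply: eq_bigr => th Hth.
  rewrite wt_at0 // mul1r /f; have [+ _] := up_parts HL Hka Hth.
  by rewrite mem_parts => /andP[_ Hth']; rewrite (path_sorted (word_sorted 0 Hth')).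
rewrite -H -kostka_inc; last 2 first.
- by rewrite rev_sorted; exact: path_sorted (word_sorted 0 Hp).
- by rewrite size_rev size_word.
rewrite [RHS]big_mkcond sum_inc_rev; apply: eq_bigr => z _.
by rewrite /f rev_sorted.
Qed.

(** On 0-1 matrices this deletes a column of sum r, which lowers r of the row sums [al] by one; the
    hypothesis on the degrees selects that number. *)
Lemma dual_pairs_cons L r nu al : (size al < L)%N -> (sumn nu < L)%N ->
  sumn al = (r + sumn nu)%N ->
  dual_pairs L (r :: nu) al = \sum_(al' <- dec al) dual_pairs L nu al'.
Proof.
move=> Hal Hnu E; have HL : (0 < L)%N by lia.
rewrite /dual_pairs exchange_big /=.
transitivity (\sum_(th <- parts L L) \sum_(ka <- dn th)
   (if (sumn ka + r == sumn th)%N then kostka nu ka * kostka al (rev (word 0 L th)) else 0)).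
  by apply: eq_bigr => th _; rewrite -/(kostka (r :: nu) th) kostka_dn mulr_suml big_mkcond.
rewrite exchange_dn_up // big_seq [RHS]big_seq; apply: eq_bigr => ka Hka.
rewrite -mulr_sumr; case: (eqVneq (kostka nu ka) 0) => [->|Hk].
  by rewrite mul0r big1 // => th _; rewrite mul0r if_same.
have Hsz : size ka = L by move: Hka; rewrite mem_parts => /andP[/eqP].
have [|Eka _ _] := Acoef_supp _ Hk; first by rewrite Hsz.
rewrite -sum_up_kostka //; last by apply: last_parts Hka _; rewrite Eka.
rewrite mulr_sumr big_seq [RHS]big_seq; apply: eq_bigr => th Hth.
have [+ _] := up_parts HL Hka Hth; rewrite mem_parts => /andP[_ Hp].
case: eqP => // Hne; apply/esym/eqP; rewrite mulf_eq0 (negPf Hk) /=.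
apply: contra_notT Hne => H.
have [|E2 _ _] := Acoef_supp _ H; first by rewrite size_rev size_word.
by move: E2; rewrite sumn_rev sumn_word // mul0n add0n => ->; rewrite Eka E addnC.
Qed.

(** Zeros cannot be lowered, and lowering a subset of the positive letters amounts to subtracting
    one from all of them and raising the complement. *)
Lemma sum_dec_word (V : nmodType) n p s (f : seq nat -> V) :
  \sum_(z <- dec (word 0 n (p :: s))) f z =
  \sum_(z <- inc (word 0 p s)) f (nseq (n - p) 0%N ++ z).
Proof.
have Hw a q v : word a.+1 q v = map S (word a q v).
  elim: v a q => [|x v IH] a q /=; first by rewrite map_nseq.
  by rewrite map_cat map_nseq -IH.
have HS w (g : seq nat -> V) : \sum_(z <- dec (map S w)) g z = \sum_(z <- inc w) g z.
  elim: w g => [|a w IH] g //; rewrite sum_inc_cons /= big_cat !big_map !IH.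
  by rewrite addrC.
rewrite /= Hw; move: (n - p)%N f => k; elim: k => [|k IH] f; first exact: HS.
by rewrite /= cats0 big_map IH.
Qed.

Lemma word_rcons0 a p s : word a p (rcons s 0%N) = word a p s.
Proof.
elim: s a p => [|x s IH] a p /=; first by rewrite subn0 cats0.
by rewrite IH.
Qed.

(* Both sides count the 0-1 matrices with column sums nu and row sums the
   partition conjugate to rho. *)
Lemma dual_pairs_word L n nu rho : (n < L)%N -> (sumn nu < L)%N ->
  rho \in parts L n -> sumn rho = sumn nu ->
  dual_pairs L nu (word 0 n rho) = Acoef (1 : int) nu rho.
Proof.
move=> Hn; elim: nu rho => [|r nu IH] rho HL Hrho E.
  have E0 : rho = nseq L 0%N.
    move: Hrho; rewrite mem_parts => /andP[/eqP <- _]; apply/all_pred1P/allP => x Hx /=.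
    by have := mem_leq_sumn Hx; rewrite E leqn0.
  rewrite E0 word_zeros /dual_pairs; have HL0 : (0 < L)%N by lia.
  have Hm M : nseq L 0%N \in parts L M.
    by rewrite mem_parts size_nseq eqxx; case: (L) => //= l; elim: l.
  rewrite (bigD1_seq (nseq L 0%N)) ?parts_uniq //= big1_seq => [|ka /andP[Hne Hka]].
    rewrite addr0 word_zeros !all_nseq orbT mul1r.
    have -> : rev (nseq L 0%N) = pad L (nseq n 0%N).
      rewrite rev_nseq; apply: (@eq_from_nth _ 0%N); rewrite ?size_nseq ?size_mkseq // => i Hi.
      by rewrite nth_mkseq // !nth_nseq !if_same.
    have := @Acoef_diag int L (nseq n 0%N) HL0; rewrite rev_nseq => ->.
    - by [].
    - by elim: (n) => //= m; case: m.
    - by rewrite size_nseq ltnW.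
  case: (boolP (all _ _)) => [/all_pred1P Ek|]; last by rewrite mul0r.
  by case/eqP: Hne; move: Hka; rewrite mem_parts => /andP[/eqP<- _].
have HLnu : (sumn nu < L)%N by apply: leq_ltn_trans HL; rewrite /= leq_addl.
have Hsz : size rho = L by move: Hrho; rewrite mem_parts => /andP[/eqP].
have Hp : path geq n rho by move: Hrho; rewrite mem_parts => /andP[].
have HL0 : (0 < L)%N by lia.
rewrite dual_pairs_cons ?size_word //; last by rewrite sumn_word.
(* Symmetry in the content is the exchange rule at t = 1, so [sum_inc_word] produces the weights of
   [Acoef] at 1. The degree is built into [f] because [dual_pairs_perm] needs it below L. *)
pose f z := if sumn z == sumn nu then dual_pairs L nu z else 0.
have Hf : exchange (1 : int) f.
  move=> u a v; rewrite mul1r /f.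
  have Hpe : perm_eq (u ++ a.+1 :: a :: v) (u ++ a :: a.+1 :: v).
    by rewrite perm_cat2l -[a.+1 :: a :: v]cat1s -[a :: a.+1 :: v](cat1s a) -(cat1s a) -(cat1s a.+1 v) perm_catCA.
  rewrite (perm_sumn Hpe); case: eqP => // Es.
  by apply: dual_pairs_perm => //; rewrite (perm_sumn Hpe) Es.
have -> : \sum_(al' <- dec (word 0 n rho)) dual_pairs L nu al' =
    \sum_(al' <- dec (word 0 n rho)) f al'.
  apply: eq_bigr => z _; rewrite /f; case: eqP => // Hne.
  by apply/eqP; apply: contra_notT Hne; exact: dual_pairs_neq0.
case: rho Hrho E Hsz Hp => [|p s] Hrho E Hsz /= Hp; first by rewrite -Hsz in HL0.
have {}Hp : (p <= n)%N /\ path geq p s by case/andP: Hp.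
case: Hp => Hpn Hp.
(* The extra zero makes the weight over [s] literally the [dnwt] of [p :: s]. *)
rewrite (sum_dec_word n p s f) -(word_rcons0 0 p s).
rewrite (sum_inc_word 0 Hf) ?last_rcons //; last by rewrite rcons_path Hp.
rewrite [RHS]big_mkcond big_seq [RHS]big_seq; apply: eq_bigr => th Hth.
have Hps : p :: s \in parts L n by exact: Hrho.
have [Hth' _] := dn_parts HL0 Hps (Hth : th \in dn (p :: s)).
have Hpth : path geq n th by move: Hth'; rewrite mem_parts => /andP[].
rewrite /f sumn_word // mul0n add0n.
have -> : (sumn th + r == p + sumn s)%N = (sumn th == sumn nu).
  by rewrite /= in E; rewrite E addnC eqn_add2l.
by case: eqP => Es; rewrite ?mulr0 // IH.
Qed.

(** As vectors indexed by eta, the values K_(eta, lambda)(1) and the chain counts have the same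
    image under the invertible A(0): a column of A(1), by [Acoef_KostkaFoulkes] at q = 1 for the
    former and by [dual_pairs_word] for the latter. *)
Lemma Kostka_conj d L n (lam eta : seq nat) : (d < L)%N -> (n < L)%N -> size lam = n ->
  sumn lam = d -> eta \in partitions d ->
  Kostka (conj_part eta) lam = kostka lam (cj L eta).
Proof.
move=> HL Hn Hlam Hd Heta; rewrite /Kostka.
set lp := to_partition lam.
have Hlp : is_partition lp by exact: to_partitionP.
have Hlps : sumn lp = d by rewrite sumn_to_partition.
have Hlpd : lp \in partitions d by rewrite mem_partitions Hlp Hlps eqxx.
have Hlpn : (size lp <= n)%N.
  by rewrite -Hlam size_filter (leq_trans (count_size _ _)) // size_sort.
have HL0 : (0 < L)%N by lia.
(* [lam] in nondecreasing order with its zero parts, written as the word of a conjugate to fit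
   [dual_pairs_word]. *)
pose w := word 0 n (cj L lp).
have Ew : w = nseq (n - size lp) 0%N ++ rev lp by rewrite /w word_cj // Hlps ltnW.
have Hw : perm_eq w lam.
  have H1 := permEl (perm_filterC (fun x => 0 < x)%N (sort geq lam)).
  apply: perm_trans (perm_trans H1 (permEl (perm_sort geq lam))).
  rewrite Ew perm_catC -[X in perm_eq _ (X ++ _)]/lp.
  have -> : [seq x <- sort geq lam | predC (fun x => 0 < x)%N x] = nseq (n - size lp) 0%N.
    set s0 := [seq x <- _ | _].
    have -> : (n - size lp = size s0)%N.
      rewrite -Hlam -(size_sort geq lam) /lp /to_partition !size_filter.
      by rewrite -(count_predC (fun x => 0 < x)%N) addKn.
    apply/all_pred1P/allP => x; rewrite mem_filter /= -leqNgt leqn0 => /andP[/eqP -> _].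
    by rewrite eqxx.
  by rewrite perm_cat2r perm_rev.
suff H eta0 : eta0 \in partitions d -> (KostkaFoulkes eta0 lp).[1] = kostka w (pad L eta0).
  rewrite H ?conj_part_partitions //; have [He Hes _] := partitionsE Heta.
  rewrite pad_conj //; apply: (@kostka_perm L) => //; last 2 first.
  - exact: size_cj.
  - by apply: (@path_sorted _ _ (size eta)); apply: path_cj.
  by rewrite (perm_sumn Hw) Hd.
have Heq al : sumn al = d -> \sum_(eta <- partitions d)
    kostka al (cj L eta) * (KostkaFoulkes eta lp).[1] =
    \sum_(eta <- partitions d) kostka al (cj L eta) * kostka w (pad L eta).
  move=> Hal; have := Acoef_KostkaFoulkes HL Hal Hlpd.
  move=> /(congr1 (horner_eval (1 : int))).
  rewrite (rmorph_Acoef (horner_eval (1 : int))) /= /horner_eval hornerX horner_sum => H1.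
  transitivity (Acoef (1 : int) al (cj L lp)).
    by rewrite H1; apply: eq_bigr => mu _; rewrite hornerM hornerC.
  rewrite -(@dual_pairs_word L n) ?Hal // ?cj_parts ?sumn_cj ?Hlps ?(ltnW HL) //.
  rewrite /dual_pairs -/w.
  transitivity (\sum_(ka <- parts L L | sumn ka == d) kostka al ka * kostka w (rev (word 0 L ka))).
    rewrite [RHS]big_mkcond big_seq [RHS]big_seq; apply: eq_bigr => ka.
    rewrite mem_parts => /andP[/eqP Hs _]; case: eqP => // Hne.
    apply/eqP; rewrite mulf_eq0; apply/orP; left; apply: contra_notT Hne => Hk.
    by have [|-> _ _] := Acoef_supp _ Hk; rewrite ?Hs.
  rewrite sum_parts ?(ltnW HL) // big_mkcond big_seq [RHS]big_seq; apply: eq_bigr => mu.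
  move=> /partitionsE[Hm Hms Hmz]; rewrite (leq_trans Hmz (ltnW HL)) rev_word_cj //.
  - by rewrite Hms ltnW.
  - exact: leq_trans Hmz (ltnW HL).
move=> Heta0; have [D HD] := Acoef_inverse HL.
have Hinv (g : seq nat -> int) : g eta0 = \sum_(al <- partitions d) D eta0 al *
    \sum_(eta <- partitions d) kostka (rev al) (cj L eta) * g eta.
  under eq_bigr do rewrite mulr_sumr; rewrite exchange_big /=.
  rewrite (eq_big_seq (fun mu => (mu == eta0)%:R * g mu)); last first.
    move=> mu Hmu /=; rewrite -(HD _ _ Heta0 Hmu) mulr_suml.
    by apply: eq_bigr => al _; rewrite mulrA.
  rewrite (bigD1_seq eta0) ?partitions_uniq //= eqxx mul1r big1 ?addr0 // => mu /negPf ->.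
  by rewrite mul0r.
rewrite (Hinv (fun mu => (KostkaFoulkes mu lp).[1])) (Hinv (fun mu => kostka w (pad L mu))).
apply: eq_big_seq => al /partitionsE[_ Hal _] /=.
by rewrite Heq // sumn_rev.
Qed.

(** * Chains of horizontal strips *)

Lemma sorted_geq_leq (s : seq nat) i j : sorted geq s -> (i <= j)%N ->
  (nth 0 s j <= nth 0 s i)%N.
Proof.
move=> Hs; elim: j => [|j IH]; first by rewrite leqn0 => /eqP->.
rewrite leq_eqVlt => /orP[/eqP-> //|]; rewrite ltnS => /IH; apply: leq_trans.
exact: sorted_geq_nth.
Qed.

Lemma includedP (nu rho : seq nat) :
  reflect (forall i, (nth 0 nu i <= nth 0 rho i)%N) (included nu rho).
Proof.
apply: (iffP forallP) => [H i|H i]; last exact: H.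
case: (ltnP i (size nu)) => Hi; first exact: (H (Ordinal Hi)).
by rewrite nth_default.
Qed.

Lemma size_skew_nodes rho nu : (forall i, (nth 0 nu i <= nth 0 rho i)%N) ->
  (size nu <= size rho)%N -> (size (skew_nodes rho nu) + sumn nu = sumn rho)%N.
Proof.
move=> H Hs; rewrite /skew_nodes size_allpairs_dep.
rewrite -[in LHS](@psum_all (size rho) nu) => [|j Hj]; last first.
  by rewrite nth_default // (leq_trans Hs).
rewrite -[RHS](@psum_all (size rho) rho) => [|j Hj]; last by rewrite nth_default.
rewrite sumnE big_map /psum /index_iota subn0 -big_split /=.
by apply: eq_bigr => i _; rewrite size_iota subnK.
Qed.

Lemma mem_skew_nodes rho nu i j :
  ((i, j) \in skew_nodes rho nu) = (i < size rho)%N && (nth 0 nu i <= j < nth 0 rho i)%N.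
Proof.
apply/allpairsPdep/andP => [[a [b [Ha Hb [-> ->]]]]|[Hi Hj]].
  by move: Ha Hb; rewrite !mem_iota /= add0n => -> ; split=> //; lia.
by exists i, j; rewrite !mem_iota /= add0n Hi; split=> //; lia.
Qed.

Lemma size_included (nu rho : seq nat) : is_partition nu ->
  (forall i, (nth 0 nu i <= nth 0 rho i)%N) -> (size nu <= size rho)%N.
Proof.
move=> /andP[_ Hnu0] H; rewrite leqNgt; apply/negP => Hlt; case/negP: Hnu0.
have := H (size rho); rewrite [X in (_ <= X)%N]nth_default // leqn0 => /eqP <-.
exact: mem_nth.
Qed.

Lemma horizontal_stripP (rho nu : seq nat) k : is_partition rho -> is_partition nu ->
  reflect ((forall i, (nth 0 rho i.+1 <= nth 0 nu i)%N /\ (nth 0 nu i <= nth 0 rho i)%N)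
    /\ (sumn nu + k = sumn rho)%N) (horizontal_strip rho nu k).
Proof.
move=> /andP[Hrho _] Hnup; have Hsz := @size_included nu rho Hnup.
have Hnu : sorted geq nu by case/andP: Hnup.
apply: (iffP and3P) => [[/includedP H1 /eqP H2 H3]|[H1 H2]].
  have Hs := size_skew_nodes H1 (Hsz H1); split; last by rewrite -H2 addnC.
  move=> i; split=> //; rewrite leqNgt; apply/negP => Hlt.
  have Hi : (i.+1 < size rho)%N.
    rewrite ltnNge; apply/negP => Hge; by rewrite (nth_default _ Hge) in Hlt.
  set s := skew_nodes rho nu in H3.
  (* If rho_(i+1) > nu_i, the column numbered nu_i from 0 contains nodes in both rows i and i +
     1. *)
  have M1 : (i, nth 0%N nu i) \in s.
    rewrite mem_skew_nodes (ltnW Hi) leqnn /=; exact: leq_trans Hlt (sorted_geq_nth _ Hrho).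
  have M2 : (i.+1, nth 0%N nu i) \in s.
    by rewrite mem_skew_nodes Hi Hlt andbT; exact: sorted_geq_nth.
  have := nth_uniq 0%N _ _ H3; rewrite size_map.
  move=> /(_ (index (i, nth 0%N nu i) s) (index (i.+1, nth 0%N nu i) s)).
  rewrite !index_mem => /(_ M1 M2); rewrite !(nth_map (0%N, 0%N)) ?index_mem // !nth_index //=.
  rewrite eqxx => /esym/eqP E.
  have := nth_index (0%N, 0%N) M1; rewrite E nth_index // => -[] /esym/eqP.
  by rewrite ltn_eqF.
have HI i : (nth 0 nu i <= nth 0 rho i)%N by have [] := H1 i.
split; first exact/includedP.
  by have := size_skew_nodes HI (Hsz HI); lia.
rewrite map_inj_in_uniq.
  apply: allpairs_uniq_dep; [exact: iota_uniq|by move=> x _; exact: iota_uniq|].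
  by move=> [a b] [c d] _ _ /= [-> ->].
have Hlt i j i' : (i < i')%N -> (i, j) \in skew_nodes rho nu -> (i', j) \notin skew_nodes rho nu.
  move=> Hi; rewrite !mem_skew_nodes => /andP[_ /andP[Hj _]].
  apply/negP => /andP[_ /andP[_ Hj']].
  have := sorted_geq_leq Hrho Hi; have [Hn _] := H1 i; lia.
move=> [i j] [i' j'] /= Hs Hs' E; rewrite -E in Hs' *.
by case: (ltngtP i i') => [/Hlt/(_ Hs)|/Hlt/(_ Hs')|-> //]; rewrite ?Hs ?Hs'.
Qed.

(** * Products of q-binomials along a chain *)

Definition pochX (m : nat) : {poly int} := \prod_(1 <= i < m.+1) (1 - 'X^i).

Lemma pochX_neq0 m : pochX m != 0.
Proof.
rewrite /pochX; elim: m => [|m IH]; first by rewrite big_geq ?oner_neq0.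
by rewrite big_nat_recr //= mulf_neq0 // subr_eq0 eq_sym polyX_expS_neq1.
Qed.

Lemma qbinomE a b c : (b <= c)%N -> (c <= a)%N ->
  qbinom (Posz a - Posz b) (Posz c - Posz b) = tofrac (gbin ('X : {poly int}) (a - b) (c - b)).
Proof.
move=> Hbc Hca; have Hba := leq_trans Hbc Hca.
rewrite (subzn Hba) (subzn Hbc) /qbinom.
have Hk : (c - b <= a - b)%N by exact: leq_sub2r.
have -> : (0 <= Posz (c - b) <= Posz (a - b))%R by rewrite lez_nat.
rewrite (subzn Hk) !absz_nat /qfact -!/(pochX _).
have P0 k : tofrac (pochX k) != 0 by rewrite tofrac_eq0 pochX_neq0.
have H : gbin ('X : {poly int}) (a - b) (c - b) * pochX (c - b) * pochX (a - b - (c - b)) = pochX (a - b).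
  apply: gbin_fact => //; first by rewrite /pochX big_geq.
  by move=> j; rewrite /pochX big_nat_recr.
have N0 := mulf_neq0 (P0 (c - b)%N) (P0 (a - b - (c - b))%N).
by apply: (mulIf N0); rewrite divfK // -H !rmorphM mulrA.
Qed.

Lemma wtE (R : comNzRingType) (t : R) p (s th : seq nat) : size th = size s ->
  wt t p s th = \prod_(0 <= i < size s)
    gbin t (nth 0%N (p :: s) i - nth 0%N s i) (nth 0%N th i - nth 0%N s i).
Proof.
elim: s p th => [|x s IH] p [|y th] //=; first by rewrite big_geq.
by move=> [Hs]; rewrite big_nat_recl //= IH.
Qed.

Lemma prod_nat_stable (R : comNzRingType) (g : nat -> R) k m : (k <= m)%N ->
  (forall i, (k <= i)%N -> g i = 1) -> \prod_(0 <= i < m) g i = \prod_(0 <= i < k) g i.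
Proof.
move=> Hk H; rewrite (big_cat_nat (n := k)) //= [X in _ * X]big_nat_cond [X in _ * X]big1 ?mulr1 //.
by move=> i /andP[/andP[Hi _] _]; exact: H.
Qed.

Definition qweight (K : nat) (rho nu : seq nat) : {fraction {poly int}} :=
  \prod_(1 <= i < K.+1) qbinom (Posz (part rho i) - Posz (part rho i.+1))
     (Posz (part nu i) - Posz (part rho i.+1)).

(** Past the length of [rho] every binomial is [0, 0] = 1, so the products up to K, which is mu_1 in
    the theorem, and up to L agree. *)
Lemma qweightE K L (rho nu : seq nat) : (size rho <= K)%N -> (size rho <= L)%N -> (0 < L)%N ->
  (size nu <= L)%N ->
  (forall i, (nth 0 rho i.+1 <= nth 0 nu i)%N /\ (nth 0 nu i <= nth 0 rho i)%N) ->
  qweight K rho nu = tofrac (dnwt ('X : {poly int}) (pad L rho) (pad L nu)).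
Proof.
move=> HK HL HL0 Hnu H.
pose g i := gbin ('X : {poly int}) (nth 0%N rho i - nth 0%N rho i.+1)
  (nth 0%N nu i - nth 0%N rho i.+1).
have g1 i : (size rho <= i)%N -> g i = 1.
  move=> Hi; have [_] := H i; rewrite /g !(@nth_default _ 0%N rho) // ?(leqW Hi) //.
  by rewrite leqn0 => /eqP->; rewrite gbin0.
have -> : qweight K rho nu = tofrac (\prod_(0 <= i < K) g i).
  rewrite rmorph_prod /qweight big_add1 /=; apply: eq_bigr => i _.
  by have [A B] := H i; rewrite /part /= qbinomE.
congr tofrac; rewrite (prod_nat_stable HK g1) -(prod_nat_stable HL g1).
have Hs : size (rcons (behead (pad L rho)) 0%N) = L.
  by rewrite size_rcons size_behead size_mkseq prednK.
rewrite /dnwt wtE ?Hs ?size_mkseq //; rewrite big_nat_cond [RHS]big_nat_cond.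
apply: eq_bigr => i /andP[/andP[_ Hi] _].
have E0 : nth 0%N (head 0%N (pad L rho) :: rcons (behead (pad L rho)) 0%N) i = nth 0%N rho i.
  rewrite -rcons_cons nth_rcons; case E: (pad L rho) => [|x s].
    by have := size_mkseq (nth 0%N rho) L; rewrite -/(pad L rho) E => E'; rewrite -E' in HL0.
  have Hz : size (x :: s) = L by rewrite -E size_mkseq.
  by rewrite /= -[(size s).+1]/(size (x :: s)) Hz Hi -E nth_pad_ge.
have E1 : nth 0%N (rcons (behead (pad L rho)) 0%N) i = nth 0%N rho i.+1.
  rewrite nth_rcons nth_behead size_behead size_mkseq nth_pad_ge //.
  case: ltnP => // H1; rewrite [RHS]nth_default; first by case: eqP.
  by apply: leq_trans HL _; rewrite -(prednK HL0).
by rewrite E0 E1 /g nth_pad_ge.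
Qed.

Lemma diagram_partition M (x : diagram M) : is_partition (val x).
Proof.
have /flattenP[_ /mapP[d _ ->]] := valP x.
by rewrite mem_partitions => /andP[].
Qed.

(** [pad L] is a bijection from the diagrams x with rho / x a horizontal strip of length r onto the
    lists of the right sum in [dn (pad L rho)]; its inverse drops the zeros. *)
Lemma Acoef_horizontal K L r al (rho : seq nat) M : is_partition rho ->
  (size rho <= K)%N -> (size rho <= L)%N -> (0 < L)%N -> (sumn rho <= M)%N ->
  tofrac (Acoef ('X : {poly int}) (r :: al) (pad L rho)) =
  \sum_(x : diagram M | horizontal_strip rho (val x) r)
    qweight K rho (val x) * tofrac (Acoef 'X al (pad L (val x))).
Proof.
move=> Hrho HK HL HL0 HM.
set s := flatten [seq partitions d | d <- iota 0 M.+1].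
have mem_s x : (x \in s) = is_partition x && (sumn x <= M)%N.
  apply/flattenP/andP => [[_ /mapP[d + ->]]|[Hx Hs]].
    by rewrite mem_iota mem_partitions add0n ltnS /= => Hd /andP[-> /eqP->].
  exists (partitions (sumn x)); last by rewrite mem_partitions Hx eqxx.
  by apply/mapP; exists (sumn x); rewrite // mem_iota add0n ltnS.
pose F x := tofrac (dnwt ('X : {poly int}) (pad L rho) x * Acoef 'X al x).
have Hsx x : is_partition x -> horizontal_strip rho x r -> (size x <= size rho)%N.
  move=> Hx /(horizontal_stripP _ Hrho Hx)[H _]; apply: size_included => // i.
  by have [] := H i.
have valP' := @diagram_partition M.
transitivity (\sum_(x : diagram M | horizontal_strip rho (val x) r) F (pad L (val x))); last first.
  apply: eq_bigr => x Hx; have Hxs := Hsx _ (valP' x) Hx.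
  case/(horizontal_stripP _ Hrho (valP' x)): (Hx) => H _.
  by rewrite /F rmorphM (@qweightE K L) // (leq_trans Hxs).
rewrite -[RHS](big_map val (fun x => horizontal_strip rho x r) (fun x => F (pad L x))).
rewrite -[RHS]big_filter -[RHS](big_map (pad L) xpredT F) /= rmorph_sum.
rewrite -[LHS]big_filter [LHS](eq_bigr F) //; apply: perm_big; apply: uniq_perm.
- exact/filter_uniq/dn_uniq.
- rewrite map_inj_in_uniq.
    by apply: filter_uniq; rewrite map_inj_uniq ?index_enum_uniq //; exact: val_inj.
  move=> a b; rewrite !mem_filter => /andP[H1 /mapP[x _ E1]] /andP[H2 /mapP[y _ E2]].
  subst; have Hx1 := Hsx _ (valP' x) H1; have Hy1 := Hsx _ (valP' y) H2.
  by apply: (pad_inj (valP' x) (valP' y)); [exact: leq_trans Hx1 HL|exact: leq_trans Hy1 HL].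
have Hpr i : nth 0%N (pad L rho) i = nth 0%N rho i by rewrite nth_pad_ge.
have HLr : (0 < size (pad L rho))%N by rewrite size_mkseq.
move=> nu; rewrite mem_filter (sumn_pad HL); apply/andP/mapP => [[/eqP Hsum]|[y + ->]].
  case/(dnP _ HLr) => Hsz H; rewrite size_mkseq in Hsz.
  have Hnu : sorted geq nu.
    apply/(sortedP 0%N) => i _ /=; have [A _] := H i; have [_ B] := H i.+1.
    exact: leq_trans B A.
  pose x := [seq y <- nu | (0 < y)%N].
  have Hx : is_partition x.
    rewrite /is_partition mem_filter andbT; apply: sorted_filter => //; exact: geq_trans.
  have Hxs : (size x <= L)%N by rewrite -Hsz size_filter count_size.
  have Ex : pad L x = nu.
    have Hc i : nth 0%N x i = nth 0%N nu i.
      rewrite /x; clear -Hnu; elim: nu i Hnu => // y nu IH i Hnu /=.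
      have Hnu' := path_sorted Hnu; case: posnP => Hy; last by case: i => //= i; rewrite IH.
      have H0 : all (pred1 0%N) nu.
        apply/allP => z Hz; move: Hnu; rewrite Hy /= path_sortedE; last exact: geq_trans.
        by move=> /andP[/allP/(_ z Hz)]; rewrite /= leqn0.
      rewrite IH // Hy; move/all_pred1P: H0 => ->.
      by case: i => [|i]; rewrite /= !nth_nseq !if_same.
    apply: (@eq_from_nth _ 0%N); rewrite size_mkseq ?Hsz // => i Hi.
    by rewrite nth_mkseq // Hc.
  have Hsx' : sumn x = sumn nu by rewrite -Ex sumn_pad.
  exists x; last by [].
  have Hxin : x \in s by rewrite mem_s Hx Hsx'; lia.
  rewrite mem_filter; apply/andP; split.
    apply/horizontal_stripP => //; split; last by rewrite Hsx'.
    by move=> i; have := H i; rewrite -Ex !nth_pad_ge.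
  by apply/mapP; exists (SeqSub Hxin); rewrite // mem_index_enum.
rewrite mem_filter => /andP[Hh /mapP[x _ E]]; subst y.
have Hxs := Hsx _ (valP' x) Hh; have HxL := leq_trans Hxs HL.
case/(horizontal_stripP _ Hrho (valP' x)): Hh => H Hsum.
split; first by apply/eqP; rewrite sumn_pad //; exact: Hsum.
 apply/(dnP _ HLr); rewrite !size_mkseq.
by split=> // i; rewrite !nth_pad_ge.
Qed.

Lemma sum_tuple_rcons (V : nmodType) (T : finType) m (G : seq T -> V) :
  \sum_(nu : m.+1.-tuple T) G nu = \sum_(x : T) \sum_(nu : m.-tuple T) G (rcons nu x).
Proof.
rewrite pair_big /=.
rewrite (reindex (fun p : T * m.-tuple T => [tuple of rcons p.2 p.1])) //=.
apply/onW_bij/inj_card_bij.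
  move=> [x u] [y v] /(congr1 val) /= /rcons_inj[E ->].
  by congr pair; apply: val_inj.
by rewrite card_prod !card_tuple expnS.
Qed.

(** Induction peels off the outermost strip, whereas [Acoef] consumes its list from the head; hence
    the reversal of [lam]. *)
Lemma Acoef_chains M K L m (lam rho : seq nat) : size lam = m.+1 -> is_partition rho ->
  (size rho <= K)%N -> (size rho <= L)%N -> (0 < L)%N -> (sumn rho <= M)%N ->
  tofrac (Acoef ('X : {poly int}) (rev lam) (pad L rho)) =
  \sum_(nu : m.-tuple (diagram M) | all (fun a => horizontal_strip
       (nth [::] (full_chain nu rho) a) (nth [::] (full_chain nu rho) a.-1) (part lam a)) (iota 1 m.+1))
    \prod_(1 <= a < m.+1) qweight K (nth [::] (full_chain nu rho) a.+1)
       (nth [::] (full_chain nu rho) a).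
Proof.
move=> + + + + HL0; elim: m lam rho => [|m IH] lam rho Hlam Hrho HK HL HM.
  (* A single strip starts from the empty diagram, whose binomials [m, 0] are 1; this is why the
     product starts at a = 1. *)
  case: lam Hlam => [|r [|? ?]] // _; rewrite (@Acoef_horizontal K L r [::] rho M) //.
  rewrite [RHS]big_mkcond (big_pred1 [tuple]) => [|nu]; last first.
    by rewrite (tuple0 nu); apply/esym/eqP.
  rewrite /= andbT big_geq // [part _ _]/=.
  have Hnil : [::] \in flatten [seq partitions d | d <- iota 0 M.+1].
    apply/flattenP; exists (partitions 0); last by rewrite mem_partitions.
    by apply/mapP; exists 0%N; rewrite // mem_iota.
  pose e : diagram M := SeqSub Hnil.
  rewrite big_mkcond (bigD1 e) //= big1 => [|x Hx].
    rewrite addr0; case: ifP => // Hh.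
    have Hn : is_partition [::] by [].
    case/(horizontal_stripP _ Hrho Hn): Hh => H _.
    rewrite (@qweightE K L) // -rmorphM.
    have -> : all (pred1 0%N) (pad L [::]) by apply/allP => y /mapP[i _ ->]; rewrite nth_nil.
    rewrite mulr1 /dnwt wtE; last first.
      by rewrite size_rcons size_behead !size_mkseq prednK.
    rewrite big1 ?rmorph1 // => i _.
    by rewrite nth_pad_ge // nth_nil sub0n gbin0.
  case: ifP => // Hh; rewrite (_ : all _ _ = false) ?rmorph0 ?mulr0 //.
  apply/negP => Hall; case/eqP: Hx; apply: val_inj => /=.
  have Hxp : is_partition (val x) := diagram_partition x.
  case/(horizontal_stripP _ Hrho Hxp): Hh => H _.
  have Hxs : (size (val x) <= L)%N.
    by apply: leq_trans HL; apply: size_included => // i; have [] := H i.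
  apply: size0nil; apply/eqP; rewrite -leqn0 (leq_trans (size_partition Hxp)) //.
  rewrite -(sumn_pad Hxs) leqn0; move/all_pred1P: Hall => ->.
  by rewrite sumn_nseq.
case/lastP: lam Hlam => // lam r; rewrite size_rcons => -[Hlam].
rewrite rev_rcons (@Acoef_horizontal K L r (rev lam) rho M) //.
pose ch (s : seq (diagram M)) top := [::] :: rcons (map val s) top.
pose lam' := rcons lam r.
pose G (s : seq (diagram M)) := if all (fun a => horizontal_strip (nth [::] (ch s rho) a)
   (nth [::] (ch s rho) a.-1) (part lam' a)) (iota 1 m.+2) then
   \prod_(1 <= a < m.+2) qweight K (nth [::] (ch s rho) a.+1) (nth [::] (ch s rho) a) else 0.
transitivity (\sum_(nu : m.+1.-tuple (diagram M)) G nu); last by rewrite [RHS]big_mkcond.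
rewrite sum_tuple_rcons big_mkcond; apply: eq_bigr => x _.
have Hnth (nu : m.-tuple (diagram M)) a : nth [::] (ch (rcons nu x) rho) a =
    if (a < m.+2)%N then nth [::] (ch nu (val x)) a else if a == m.+2 then rho else [::].
  rewrite /ch map_rcons -rcons_cons nth_rcons.
  by rewrite -[size _]/(size (rcons (map val nu) (val x))).+1 size_rcons size_map size_tuple.
have HG (nu : m.-tuple (diagram M)) : G (rcons nu x) =
   if all (fun a => horizontal_strip (nth [::] (ch nu (val x)) a)
      (nth [::] (ch nu (val x)) a.-1) (part lam a)) (iota 1 m.+1) && horizontal_strip rho (val x) r
   then (\prod_(1 <= a < m.+1) qweight K (nth [::] (ch nu (val x)) a.+1) (nth [::] (ch nu (val x)) a))
     * qweight K rho (val x) else 0.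
  have Hlast : nth [::] (ch nu (val x)) m.+1 = val x.
    by rewrite /= nth_rcons size_map size_tuple ltnn eqxx.
  have E1 a : (a < m.+2)%N -> nth [::] (ch (rcons nu x) rho) a = nth [::] (ch nu (val x)) a.
    by move=> Ha; rewrite Hnth Ha.
  have E2 : nth [::] (ch (rcons nu x) rho) m.+2 = rho by rewrite Hnth ltnn eqxx.
  have Ei : iota 1 m.+2 = iota 1 m.+1 ++ [:: m.+2] by rewrite -[in LHS](addn1 m.+1) iotaD add1n.
  have Er : part lam' m.+2 = r by rewrite /part /lam' nth_rcons Hlam ltnn eqxx.
  rewrite /G Ei all_cat all_seq1 E2 [m.+2.-1]/= E1 // Hlast Er.
  congr (if _ && _ then _ else _).
    apply: eq_in_all => a; rewrite mem_iota => Ha.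
    rewrite (E1 a) ?(E1 a.-1); [|lia|lia]; congr horizontal_strip.
    by rewrite /part /lam' nth_rcons Hlam; case: ltnP => //; lia.
  rewrite big_nat_recr // [X in _ * X]/= E2 E1 // Hlast; congr (_ * _).
  by apply: eq_big_nat => a /andP[_ Ha]; rewrite !E1 // ltnW.
case: ifPn => Hh; last first.
  by rewrite big1 // => nu _; rewrite HG (negPf Hh) andbF.
have Hxp : is_partition (val x) := diagram_partition x.
case/(horizontal_stripP _ Hrho Hxp): (Hh) => H Hsum.
have Hxs : (size (val x) <= size rho)%N.
  by apply: size_included => // i; have [] := H i.
rewrite (IH lam (val x)) ?(leq_trans Hxs) //; last by apply: leq_trans HM; lia.
rewrite mulr_sumr big_mkcond; apply: eq_bigr => nu _.
by rewrite HG Hh andbT; case: ifP => // _; rewrite mulrC.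
Qed.

(** * Comparison of the two expansions *)

Unset Implicit Arguments.

Theorem proposition4p3 (n : nat) (mu : seq nat) (lam : n.-tuple nat)
    (n_ge2 : (2 <= n)%N) (mu_part : is_partition mu)
    (lam_mu : sumn lam = sumn mu) (mu1_le : (part mu 1 <= n - 1)%N) :
  tofrac (\sum_(eta <- partitions (sumn mu) | (part eta 1 <= n)%N)
            (Kostka (conj_part eta) lam)%:P * KostkaFoulkes eta mu : {poly int})
  = \sum_(nu : n.-1.-tuple (diagram (sumn mu))
           | strip_chain lam (full_chain nu (conj_part mu)))
      \prod_(1 <= a < n) \prod_(1 <= i < (part mu 1).+1)
        qbinom
          (Posz (part (nth [::] (full_chain nu (conj_part mu)) a.+1) i)
           - Posz (part (nth [::] (full_chain nu (conj_part mu)) a.+1) i.+1))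
          (Posz (part (nth [::] (full_chain nu (conj_part mu)) a) i)
           - Posz (part (nth [::] (full_chain nu (conj_part mu)) a.+1) i.+1)).
Proof.
(* [Kostka_conj] needs L above both the degree and the number n of strips. *)
pose d := sumn mu; pose L := (d + n).+1.
have dL : (d < L)%N by rewrite /L; lia.
have nL : (n < L)%N by rewrite /L; lia.
have mu_in : mu \in partitions d by rewrite mem_partitions mu_part eqxx.
have size_lam : size lam = n by exact: size_tuple.
have kostka_rev eta : kostka (rev lam) (cj L eta) = kostka lam (cj L eta).
  apply: (@kostka_perm L); rewrite ?sumn_rev ?lam_mu ?perm_rev ?size_cj //.
  by apply: (@path_sorted _ _ (size eta)); exact: path_cj.
have -> : \sum_(eta <- partitions (sumn mu) | (part eta 1 <= n)%N)
    (Kostka (conj_part eta) lam)%:P * KostkaFoulkes eta mu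
    = Acoef ('X : {poly int}) (rev lam) (cj L mu).
  rewrite (@Acoef_KostkaFoulkes d) ?sumn_rev // big_mkcond; apply: eq_big_seq => eta Heta.
  rewrite (@Kostka_conj d L n) // kostka_rev; case: ifPn => //; rewrite -ltnNge => eta1_gt.
  (* If eta_1 > n, then eta' has more than n rows and no chain of n strips reaches it. *)
  suff -> : kostka lam (cj L eta) = 0 by rewrite polyC0 mul0r.
  apply/eqP; apply: contraLR eta1_gt => /Acoef_supp[|_ H _]; first by rewrite size_cj.
  have := H n; rewrite size_lam nth_mkseq // => /(_ (leqnn n))/eqP.
  rewrite -leqn0 leqNgt -has_count -leqNgt => /hasPn H'.
  by case: eta Heta H H' => //= x eta _ _ /(_ x (mem_head _ _)); rewrite -leqNgt.
rewrite -(pad_conj L mu_part).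
have conj_mu := conj_partP mu_part; have size_conj := size_conj_part mu.
have head_mu : head 0%N mu = part mu 1 by case: (mu).
have head_le := head_leq_sumn mu.
case: n lam n_ge2 size_lam {lam_mu mu1_le kostka_rev} @L dL nL => // m lam _ size_lam L dL nL.
rewrite (@Acoef_chains (sumn mu) (part mu 1) L m lam) //.
- by rewrite size_conj head_mu.
- by rewrite size_conj (leq_trans head_le) // ltnW.
- by rewrite sumn_conj_part.
Qed.
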